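(* Let $\mathcal{S}$ be a finite set of positive integers each greater than $1$. Then the ordinary generating function $T^c(t)=\sum_{n\geq0}t^c_nt^n$, where $t^c_n$ is the number of (unlabelled) complete rooted plane $\mathcal{S}$-trees with $n$ leaves, is differentially transcendental over $\mathbb{C}(t)$.
   Context: A rooted plane tree is a finite rooted tree in which the children of each vertex are linearly ordered; a leaf is a vertex with no children, and size is the number of leaves. An $\mathcal{S}$-tree is a rooted plane tree in which every non-leaf vertex has $k$ children for some $k\in\mathcal{S}$; it is complete if all leaves are at the same distance from the root (the single vertex is a complete tree with one leaf). Differentially transcendental over $\mathbb{C}(t)$: no nonzero polynomial $P$ over $\mathbb{C}(t)$ with $P(f,f',\dots,f^{(n)})=0$.
   Formalization: The set S is assumed nonempty: for S empty the only complete S-tree is the single vertex, so T^c(t) = t, which is algebraic and the claim fails. *)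

(* Defs.v *)
From HB Require Import structures.
From mathcomp Require Import all_boot all_order all_algebra finmap mpoly.
From mathcomp Require Import boolp classical_sets cardinality reals complex.

Set Implicit Arguments.
Unset Strict Implicit.
Unset Printing Implicit Defensive.

Import GRing.Theory.
Local Open Scope ring_scope.

Record fps (F : Type) := FPS { coefs : nat -> F }.

HB.instance Definition _ (F : Type) := gen_eqMixin (fps F).
HB.instance Definition _ (F : Type) := gen_choiceMixin (fps F).

Section Fps.
Variable F : fieldType.
Implicit Types f g h : fps F.

Lemma fpsP f g : coefs f =1 coefs g -> f = g.
Proof. by case: f => f; case: g => g /= /funext ->. Qed.

Definition fps0 : fps F := FPS (fun=> 0).
Definition fps1 : fps F := FPS (fun n => (n == 0%N)%:R).
Definition fps_add f g := FPS (fun n => coefs f n + coefs g n).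
Definition fps_opp f := FPS (fun n => - coefs f n).
Definition fps_mul f g :=
  FPS (fun n => \sum_(i < n.+1) coefs f i * coefs g (n - i)%N).

Fact fps_addA : associative fps_add.
Proof. by move=> f g h; apply: fpsP => n /=; rewrite addrA. Qed.
Fact fps_addC : commutative fps_add.
Proof. by move=> f g; apply: fpsP => n /=; rewrite addrC. Qed.
Fact fps_add0 : left_id fps0 fps_add.
Proof. by move=> f; apply: fpsP => n /=; rewrite add0r. Qed.
Fact fps_addN : left_inverse fps0 fps_opp fps_add.
Proof. by move=> f; apply: fpsP => n /=; rewrite addNr. Qed.

HB.instance Definition _ :=
  GRing.isZmodule.Build (fps F) fps_addA fps_addC fps_add0 fps_addN.

Fact fps_mulC : commutative fps_mul.
Proof.
move=> f g; apply: fpsP => n /=; rewrite (reindex_inj rev_ord_inj) /=.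
apply: eq_bigr => i _; rewrite subSS subKn 1?mulrC //.
by rewrite -ltnS ltn_ord.
Qed.

Let trunc f n : {poly F} := \poly_(i < n.+1) coefs f i.

Let mul_trunc f g n m : (n <= m)%N ->
  coefs (fps_mul f g) n = (trunc f m * trunc g m)`_n.
Proof.
move=> nm; rewrite coefM; apply: eq_bigr => i _; rewrite !coef_poly.
have lei : (i <= n)%N by rewrite -ltnS ltn_ord.
by rewrite !ltnS (leq_trans lei nm) (leq_trans (leq_subr _ _) nm).
Qed.

Fact fps_mulA : associative fps_mul.
Proof.
move=> f g h; apply: fpsP => n.
transitivity ((trunc f n * (trunc g n * trunc h n))`_n).
  rewrite coefM /=; apply: eq_bigr => i _; rewrite coef_poly ltn_ord.
  by rewrite -(mul_trunc _ _ (leq_subr i n)).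
rewrite mulrA coefM /=; apply: eq_bigr => i _.
have lei : (i <= n)%N by rewrite -ltnS ltn_ord.
by rewrite -(mul_trunc f g lei) coef_poly ltnS leq_subr.
Qed.

Fact fps_mul1 : left_id fps1 fps_mul.
Proof.
move=> f; apply: fpsP => n /=; rewrite big_ord_recl /= subn0 mul1r.
by rewrite big1 ?addr0 // => i _; rewrite /= mul0r.
Qed.

Fact fps_mulDl : left_distributive fps_mul fps_add.
Proof.
move=> f g h; apply: fpsP => n /=; rewrite -big_split /=.
by apply: eq_bigr => i _; rewrite mulrDl.
Qed.

Fact fps_1neq0 : fps1 != 0 :> fps F.
Proof. by apply/eqP => -[] /(congr1 (@^~ 0%N)) /eqP; rewrite oner_eq0. Qed.

HB.instance Definition _ := GRing.Zmodule_isComNzRing.Build (fps F)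
  fps_mulA fps_mulC fps_mul1 fps_mulDl fps_1neq0.

Lemma coefsD f g n : coefs (f + g) n = coefs f n + coefs g n.
Proof. by []. Qed.

Lemma coefsM f g n :
  coefs (f * g) n = \sum_(i < n.+1) coefs f i * coefs g (n - i)%N.
Proof. by []. Qed.

Definition fps_unit : pred (fps F) := fun f => `[< exists g, g * f = 1 >].
Definition fps_inv f : fps F :=
  if pselect (exists g, g * f = 1) is left h then projT1 (cid h) else f.

Fact fps_mulV : {in fps_unit, left_inverse 1 fps_inv *%R}.
Proof.
move=> f /asboolP fU; rewrite /fps_inv; case: pselect => [h|/(_ fU)//].
exact: projT2 (cid h).
Qed.

Fact fps_unitP f g : g * f = 1 -> fps_unit f.
Proof. by move=> fg; apply/asboolP; exists g. Qed.

Fact fps_inv_out : {in [predC fps_unit], fps_inv =1 id}.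
Proof.
move=> f /= /negP fU; rewrite /fps_inv; case: pselect => // h.
by case: fU; apply/asboolP.
Qed.

HB.instance Definition _ := GRing.ComNzRing_hasMulInverse.Build (fps F)
  fps_mulV fps_unitP fps_inv_out.

Lemma fps_neq0P f : f != 0 ->
  exists n, coefs f n != 0 /\ forall i, (i < n)%N -> coefs f i = 0.
Proof.
move=> f0; have exn : exists n, coefs f n != 0.
  apply: contrapT => /forallNP h; case/eqP: f0; apply: fpsP => n /=.
  by apply/eqP/negPn/negP; exact: h.
have [n fn min] := ex_minnP exn; exists n; split=> // i lti.
by apply: contraTeq lti => /min; rewrite -leqNgt.
Qed.

Fact fps_mulf_eq0 f g : f * g = 0 -> (f == 0) || (g == 0).
Proof.
move=> fg0; apply: contrapT => /negP; rewrite negb_or => /andP[].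
move=> /fps_neq0P[m [fm minf]] /fps_neq0P[n [gn ming]].
have : coefs (f * g) (m + n) = 0 by rewrite fg0.
have ltm : (m < (m + n).+1)%N by rewrite ltnS leq_addr.
rewrite coefsM (bigD1 (Ordinal ltm)) //= addKn big1 ?addr0.
  by move/eqP; rewrite mulf_eq0 (negPf fm) (negPf gn).
move=> i; rewrite -val_eqE /= neq_ltn => /orP[/minf->|ltmi].
  by rewrite mul0r.
rewrite [X in _ * X]ming ?mulr0 // ltn_subLR ?ltn_add2r //.
by rewrite -ltnS ltn_ord.
Qed.

HB.instance Definition _ :=
  GRing.ComUnitRing_isIntegral.Build (fps F) fps_mulf_eq0.

Definition fps_deriv f : fps F := FPS (fun n => coefs f n.+1 *+ n.+1).

Definition fps_of_poly (p : {poly F}) : fps F := FPS (fun n => p`_n).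

Fact fps_of_poly_is_zmod_morphism : zmod_morphism fps_of_poly.
Proof. by move=> p q; apply: fpsP => n /=; rewrite coefB. Qed.

Fact fps_of_poly_is_monoid_morphism : monoid_morphism fps_of_poly.
Proof.
split; first by apply: fpsP => n /=; rewrite coef1.
by move=> p q; apply: fpsP => n /=; rewrite coefM.
Qed.

HB.instance Definition _ := GRing.isZmodMorphism.Build _ _ fps_of_poly
  fps_of_poly_is_zmod_morphism.
HB.instance Definition _ := GRing.isMonoidMorphism.Build _ _ fps_of_poly
  fps_of_poly_is_monoid_morphism.

Lemma fps_of_poly_inj : injective fps_of_poly.
Proof.
by move=> p q [] pq; apply/polyP => n; have := congr1 (@^~ n) pq.
Qed.

End Fps.

(* F((t)) is realized as the fraction field of F[[t]]. *)
Notation laurent F := {fraction fps F}.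
Notation ratfun F := {fraction {poly F}}.

Section Laurent.
Variable F : fieldType.
Local Notation tf := (@FracField.tofrac _).

Definition laurent_of_fps (f : fps F) : laurent F := tf f.

Definition laurent_of_ratfun (x : ratfun F) : laurent F :=
  laurent_of_fps (fps_of_poly \n_(repr x))
  / laurent_of_fps (fps_of_poly \d_(repr x)).

Lemma laurent_of_poly_eq0 (p : {poly F}) :
  (laurent_of_fps (fps_of_poly p) == 0) = (p == 0).
Proof.
rewrite /laurent_of_fps tofrac_eq0 -(inj_eq (@fps_of_poly_inj F)).
by rewrite rmorph0.
Qed.

Lemma ratfun_repr (x : ratfun F) : x = tf \n_(repr x) / tf \d_(repr x).
Proof.
have d0 : tf \d_(repr x) != 0 by rewrite tofrac_eq0 denom_ratioP.
apply: (mulIf d0); rewrite divfK //; move: d0; rewrite -[X in _ -> X * _ = _]reprK.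
case: (repr x) => -[n d] /= d0 _; unlock FracField.tofrac.
rewrite -[LHS]FracField.pi_mul; apply/eqmodP.
rewrite /= FracField.equivfE /FracField.mulf /=.
by rewrite !numden_Ratio ?mulr1 ?oner_eq0 //= mulrC.
Qed.

Lemma laurent_of_ratfunE (p q : {poly F}) : q != 0 ->
  laurent_of_ratfun (tf p / tf q) =
  laurent_of_fps (fps_of_poly p) / laurent_of_fps (fps_of_poly q).
Proof.
move=> q0; rewrite /laurent_of_ratfun; set x := tf p / tf q.
have d0 : \d_(repr x) != 0 by rewrite denom_ratioP.
apply/eqP; rewrite eqr_div ?laurent_of_poly_eq0 //.
rewrite /laurent_of_fps -!rmorphM tofrac_eq.
rewrite (inj_eq (@fps_of_poly_inj F)) -(tofrac_eq (_ * q)) !rmorphM /=.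
by rewrite -eqr_div ?tofrac_eq0 // -ratfun_repr.
Qed.

Fact laurent_of_ratfun_is_zmod_morphism : zmod_morphism laurent_of_ratfun.
Proof.
move=> x y; rewrite {1}[x]ratfun_repr {1}[y]ratfun_repr.
have dx0 : \d_(repr x) != 0 by rewrite denom_ratioP.
have dy0 : \d_(repr y) != 0 by rewrite denom_ratioP.
rewrite -mulNr addf_div ?tofrac_eq0 // -rmorphN -!rmorphM -rmorphD.
rewrite laurent_of_ratfunE ?mulf_neq0 // /laurent_of_ratfun -mulNr.
by rewrite addf_div ?laurent_of_poly_eq0 // /laurent_of_fps !(rmorphD, rmorphM, rmorphN).
Qed.

Fact laurent_of_ratfun_is_monoid_morphism : monoid_morphism laurent_of_ratfun.
Proof.
split=> [|x y].
  rewrite -[1 in LHS]divr1 -!(rmorph1 tf) laurent_of_ratfunE ?oner_eq0 //.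
  by rewrite divff // laurent_of_poly_eq0 oner_eq0.
rewrite {1}[x]ratfun_repr {1}[y]ratfun_repr.
have dx0 : \d_(repr x) != 0 by rewrite denom_ratioP.
have dy0 : \d_(repr y) != 0 by rewrite denom_ratioP.
rewrite mulf_div -!rmorphM laurent_of_ratfunE ?mulf_neq0 //.
by rewrite /laurent_of_ratfun mulf_div /laurent_of_fps !rmorphM.
Qed.

HB.instance Definition _ := GRing.isZmodMorphism.Build _ _ laurent_of_ratfun
  laurent_of_ratfun_is_zmod_morphism.
HB.instance Definition _ := GRing.isMonoidMorphism.Build _ _ laurent_of_ratfun
  laurent_of_ratfun_is_monoid_morphism.

(* P(f, f', ..., f^(n)), where F(t) acts on F((t)) through laurent_of_ratfun. *)
Definition diff_eval (n : nat) (P : {mpoly (ratfun F)[n.+1]}) (f : fps F) :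
    laurent F :=
  mmap laurent_of_ratfun
    (fun i : 'I_n.+1 => laurent_of_fps (iter i (@fps_deriv F) f)) P.

Definition diff_transcendental (f : fps F) : Prop :=
  forall (n : nat) (P : {mpoly (ratfun F)[n.+1]}),
    P != 0 -> diff_eval P f != 0.

End Laurent.

(* A vertex is given by the ordered sequence of the subtrees rooted at its
   children. *)
Inductive ptree := Node of seq ptree.

HB.instance Definition _ := gen_eqMixin ptree.
HB.instance Definition _ := gen_choiceMixin ptree.

(* The distances from the root to each of the leaves, from left to right. *)
Fixpoint leaf_depths (T : ptree) : seq nat :=
  let: Node cs := T in
  if nilp cs then [:: 0%N] else map succn (flatten (map leaf_depths cs)).

Definition nleaves (T : ptree) : nat := size (leaf_depths T).

Definition complete_tree (T : ptree) : bool := constant (leaf_depths T).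

Fixpoint is_Stree (S : {fset nat}) (T : ptree) : bool :=
  let: Node cs := T in
  (nilp cs || (size cs \in S)) && all (is_Stree S) cs.

Definition complete_Strees (S : {fset nat}) (n : nat) : set ptree :=
  [set T | [/\ is_Stree S T, complete_tree T & nleaves T = n]]%classic.

(* [fset_set] is meaningful only on finite sets: see
   [finite_complete_Strees] below. *)
Definition ncomplete (S : {fset nat}) (n : nat) : nat :=
  #|` fset_set (complete_Strees S n)|%fset.

Definition complete_gf (F : fieldType) (S : {fset nat}) : fps F :=
  FPS (fun n => (ncomplete S n)%:R).

Lemma ptree_nested_ind (P : ptree -> Prop) :
  (forall cs, (forall c, c \in cs -> P c) -> P (Node cs)) -> forall T, P T.
Proof.
move=> PN; fix IH 1 => -[cs]; apply: PN; elim: cs => [d|c cs IHcs d].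
  by clear IH; rewrite in_nil.
rewrite in_cons => /predU1P[->|]; [exact: IH | exact: IHcs].
Qed.

Lemma nleaves_Node cs :
  nleaves (Node cs) = if nilp cs then 1%N else sumn (map nleaves cs).
Proof.
rewrite /nleaves /=; case: ifP => //= _.
by rewrite size_map size_flatten /shape -map_comp.
Qed.

Lemma nleaves_gt0 T : (0 < nleaves T)%N.
Proof.
elim/ptree_nested_ind: T => -[//|c cs] IH.
by rewrite nleaves_Node /= addn_gt0 IH ?mem_head.
Qed.

Fixpoint seqs_upto (A : Type) (s : seq A) (m : nat) : seq (seq A) :=
  if m is m'.+1 then
    [::] :: [seq x :: l | x <- s, l <- seqs_upto s m']
  else [:: [::]].

Lemma mem_seqs_upto (A : eqType) (s l : seq A) m :
  (size l <= m)%N -> {subset l <= s} -> l \in seqs_upto s m.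
Proof.
elim: m l => [|m IH] [|x l] //= lm ls; rewrite inE; apply/orP; right.
apply: allpairs_f; first by apply: ls; rewrite mem_head.
by apply: IH => // y yl; apply: ls; rewrite inE yl orbT.
Qed.

Fixpoint trees_upto (n m : nat) : seq ptree :=
  if m is m'.+1 then map Node (seqs_upto (trees_upto n m') n)
  else [::].

Lemma size_le_sumn_nleaves cs : (size cs <= sumn (map nleaves cs))%N.
Proof.
elim: cs => //= c cs IH; rewrite -add1n.
exact: leq_add (nleaves_gt0 c) IH.
Qed.

Lemma nleaves_child c cs : c \in cs ->
  (nleaves c + (size cs).-1 <= sumn (map nleaves cs))%N.
Proof.
elim: cs => //= d cs IH; rewrite inE => /predU1P[->|ccs].
  by rewrite leq_add2l size_le_sumn_nleaves.
have := IH ccs; have := nleaves_gt0 d; case: cs {IH} ccs => // e cs _ d0 /= h.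
by rewrite addnS -add1n leq_add.
Qed.

Lemma Stree_in_trees_upto (S : {fset nat}) T n m :
    (forall k, k \in S -> (1 < k)%N) ->
  is_Stree S T -> (nleaves T <= n)%N -> (nleaves T <= m)%N ->
  T \in trees_upto n m.
Proof.
move=> S1; elim/ptree_nested_ind: T m => cs IH m ST len.
case: m => [|m] lem; first by have := nleaves_gt0 (Node cs); rewrite lt0n -leqn0 lem.
apply: map_f; case/andP: ST => /orP[/nilP-> _|/S1 sz1 /allP allS].
  by apply: mem_seqs_upto.
move: len lem; rewrite nleaves_Node /nilp; case: eqVneq sz1 => [->//|_ sz1].
move=> len lem; apply: mem_seqs_upto.
  exact: leq_trans (size_le_sumn_nleaves cs) len.
move=> c ccs; have lec := nleaves_child ccs; apply: IH => //.
- exact: allS.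
- exact: leq_trans (leq_trans (leq_addr _ _) lec) len.
- rewrite -ltnS; apply: leq_trans (leq_trans lec lem).
  by case: (size cs) sz1 => [|[|k]] //= _; rewrite -addn1 leq_add2l.
Qed.

Lemma finite_complete_Strees (S : {fset nat}) (n : nat) :
  (forall k, k \in S -> (1 < k)%N) -> finite_set (complete_Strees S n).
Proof.
move=> S1; apply: (@sub_finite_set _ _ [set` trees_upto n n]%classic).
  by move=> T /= [ST _ <-]; apply: (Stree_in_trees_upto S1).
exact: finite_seq.
Qed.

(* Main.v *)
Require Import Defs.
From mathcomp Require Import all_boot all_order all_algebra finmap.
From mathcomp Require Import reals complex.
From HB Require Import structures.
From mathcomp Require Import boolp classical_sets cardinality perm mpoly zify ring.

Set Implicit Arguments.
Unset Strict Implicit.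
Unset Printing Implicit Defensive.

Import Order.TTheory GRing.Theory Num.Theory.
Local Open Scope ring_scope.

(* Let P = sum_{k in S} t^k, of degree d > 1. Grouping complete trees by height
   gives f = t + P + P(P) + ..., hence f = t + f(P). Composition sigma with P
   and the Euler derivation D = t d/dt satisfy P D sigma = (t P') sigma D, so
   with B = t P' one gets
     B^(2i) sigma(D^i f) = sum_(j <= i) lam_ij (D^j f - t)
   where lam_ij is a polynomial of degree at most 2id whose coefficient of
   degree 2id is d^i if i = j and 0 otherwise.

   Suppose f, D f, ..., D^n f are algebraically dependent over F[t], and let Q
   be a relation with minimal leading monomial. Applying sigma yields another
   relation tau Q with at most the same leading monomial, so Q is semi-invariant:
   q tau Q = c Q with q, c in F[t].

   Comparing the t-degrees of the coefficients excludes this. On forms of top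
   degree N in the variables, tau acts to leading order in t by eigenvalues
   that are distinct on the variables, and it multiplies t-degrees by d. The
   shift of D^j f by t creates, in degree N - 1, a term whose t-degree is one
   more than that of the top forms; the other terms cannot cancel it, just as
   h(P) - h = t has no rational solution h because d > 1. *)

(** * Polynomials with a prescribed coefficient in the top degree *)

Section Top.
Variable F : fieldType.
Implicit Types p q P : {poly F}.

(** The value [c] may be zero: the relation is then stable under sums, and cancellations in the top
    degree can be tracked. *)
Definition top (k : nat) p (c : F) := (size p <= k.+1)%N /\ p`_k = c.

Lemma top0 k : top k 0 0.
Proof. by split; rewrite ?size_poly0 ?coef0. Qed.

Lemma topD k p q c e : top k p c -> top k q e -> top k (p + q) (c + e).
Proof.
move=> [sp <-] [sq <-]; split; last by rewrite coefD.
by apply: leq_trans (size_polyD _ _) _; rewrite geq_max sp.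
Qed.

Lemma topN k p c : top k p c -> top k (- p) (- c).
Proof. by move=> [sp <-]; split; rewrite ?size_polyN ?coefN. Qed.

Lemma topB k p q c e : top k p c -> top k q e -> top k (p - q) (c - e).
Proof. by move=> pc /topN; apply: topD. Qed.

Lemma topMn k p c n : top k p c -> top k (p *+ n) (c *+ n).
Proof.
move=> tp; elim: n => [|n IH]; first by rewrite !mulr0n; apply: top0.
by rewrite !mulrS; apply: topD.
Qed.

Lemma top_sum k (I : Type) (r : seq I) (Q : pred I) (p : I -> {poly F}) (c : I -> F) :
  (forall i, Q i -> top k (p i) (c i)) ->
  top k (\sum_(i <- r | Q i) p i) (\sum_(i <- r | Q i) c i).
Proof.
move=> h; elim/big_rec2: _ => [|i x y Qi]; first exact: top0.
by apply: topD; apply: h.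
Qed.

Lemma topC c : top 0 c%:P c.
Proof. by split; rewrite ?coefC ?size_polyC_leq1. Qed.

Lemma topX : top 1 'X 1.
Proof. by split; rewrite ?size_polyX ?coefX. Qed.

Lemma topM k l p q c e : top k p c -> top l q e -> top (k + l) (p * q) (c * e).
Proof.
move=> [sp pc] [sq qe]; split.
  by apply: leq_trans (size_polyMleq _ _) _; lia.
have ltk : (k < (k + l).+1)%N by lia.
rewrite coefM (bigD1 (Ordinal ltk)) //= pc addKn qe big1 ?addr0 // => i.
rewrite -val_eqE /= neq_ltn => /orP[lti|gti].
  rewrite [X in _ * X]nth_default ?mulr0 //; apply: leq_trans sq _.
  by have := ltn_ord i; lia.
by rewrite [X in X * _]nth_default ?mul0r //; apply: leq_trans sp _.
Qed.

Lemma top_exp k p c n : top k p c -> top (k * n) (p ^+ n) (c ^+ n).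
Proof.
move=> tp; elim: n => [|n IH]; first by rewrite muln0 !expr0; apply: topC.
by rewrite mulnS !exprS; apply: topM.
Qed.

Lemma top_widen k l p c : (k < l)%N -> top k p c -> top l p 0.
Proof.
move=> kl [sp _]; have sl : (size p <= l)%N by apply: leq_trans sp kl.
by split; [apply: leqW | rewrite nth_default].
Qed.

Lemma top_inj k p c e : top k p c -> top k p e -> c = e.
Proof. by move=> [_ <-] [_ <-]. Qed.

Lemma top_eq k l p c e : top k p c -> top l p e -> c != 0 -> e != 0 ->
  k = l /\ c = e.
Proof.
move=> tk tl c0 e0; have [kl|lk|kl] := ltngtP k l.
- by have := top_inj (top_widen kl tk) tl; move/eqP; rewrite eq_sym (negPf e0).
- by have := top_inj (top_widen lk tl) tk; move/eqP; rewrite eq_sym (negPf c0).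
- by split=> //; move: tl; rewrite -kl; apply: top_inj.
Qed.

Lemma top_lead p : p != 0 -> top (size p).-1 p (lead_coef p).
Proof. by move=> p0; split; rewrite ?prednK ?size_poly_gt0. Qed.

Lemma top_neq0 k p c : top k p c -> c != 0 -> p != 0.
Proof. by move=> [_ <-]; apply: contraNneq => ->; rewrite coef0. Qed.

(** [P ^+ i] has degree [d * i] and leading coefficient 1, so only [i = k] reaches degree
    [d * k]. *)
Lemma top_comp d P k p c : (0 < d)%N -> top d P 1 -> top k p c ->
  top (d * k) (p \Po P) c.
Proof.
move=> d0 tP [sp <-]; rewrite comp_polyE.
(* When [k] is at least [size p], no index equals [k] and both sides of the next equality vanish. *)
pose g (i : 'I_(size p)) := if i == k :> nat then p`_k else 0.
have -> : p`_k = \sum_(i < size p) g i.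
  have [kp|kp] := ltnP k (size p).
    rewrite (bigD1 (Ordinal kp)) //= /g eqxx big1 ?addr0 // => i.
    by rewrite -val_eqE /= => /negPf->.
  rewrite nth_default // big1 // => i _; rewrite /g; case: eqP => // ik.
  by rewrite nth_default.
apply: top_sum => i _; rewrite /g -mul_polyC.
have tPi := topM (topC p`_i) (top_exp i tP).
rewrite expr1n mulr1 add0n in tPi.
case: eqP => [<- //|/eqP ik].
apply: top_widen tPi; rewrite ltn_pmul2l // ltn_neqAle ik.
by have := ltn_ord i; lia.
Qed.

Lemma top_Xderiv k p c : top k p c -> top k ('X * p^`()) (c *+ k).
Proof.
move=> [sp <-]; split; last first.
  by rewrite coefXM coef_deriv; case: k {sp} => [|k]; rewrite ?mulr0n.
have [->|p0] := eqVneq p 0; first by rewrite derivC mulr0 size_poly0.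
apply: leq_trans (size_polyMleq _ _) _; rewrite size_polyX addSn add1n /=.
exact: leq_trans (lt_size_deriv p0) sp.
Qed.

End Top.

(** * Multivariate polynomials over F[t] *)

Section TopMpoly.
Variables (F : fieldType) (r : nat).
Implicit Types (G H : {mpoly {poly F}[r]}) (g h : {mpoly F[r]}) (m : 'X_{1..r}).

Definition topm k G g := forall m, top k G@_m g@_m.

Lemma topm1 : topm 0 1 1.
Proof. by move=> m; rewrite !mcoeff1 -polyC_natr; apply: topC. Qed.

Lemma topmM k l G g H h : topm k G g -> topm l H h -> topm (k + l) (G * H) (g * h).
Proof.
by move=> tG tH m; rewrite !mcoeffM; apply: top_sum => i _; apply: topM.
Qed.

Lemma topm_exp k G g n : topm k G g -> topm (k * n) (G ^+ n) (g ^+ n).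
Proof.
move=> tG; elim: n => [|n IH]; first by rewrite muln0 !expr0; apply: topm1.
by rewrite mulnS !exprS; apply: topmM.
Qed.

Lemma topm_mmap1 k (G : 'I_r -> {mpoly {poly F}[r]}) (g : 'I_r -> {mpoly F[r]}) m :
  (forall i, topm k (G i) (g i)) -> topm (k * mdeg m) (mmap1 G m) (mmap1 g m).
Proof.
move=> tG; rewrite mdegE big_distrr /mmap1 /=.
elim/big_rec3: _ => [|i x G' l _ IH]; first exact: topm1.
by apply: topmM; first exact: topm_exp.
Qed.

End TopMpoly.

(** * Substitutions and translations, controlled by total degree *)

Section DegreeBound.
Variables (R : comNzRingType) (r : nat).
Implicit Types (G H : {mpoly R[r]}) (m : 'X_{1..r}).

Lemma mcoeff_sum (I : Type) (s : seq I) (Q : pred I) (G : I -> {mpoly R[r]}) m :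
  (\sum_(i <- s | Q i) G i)@_m = \sum_(i <- s | Q i) (G i)@_m.
Proof. exact: raddf_sum. Qed.

Definition degree_lt k G := forall m, (k <= mdeg m)%N -> G@_m = 0.

Lemma degree_lt0 k : degree_lt k 0.
Proof. by move=> m _; rewrite mcoeff0. Qed.

Lemma degree_ltD k G H : degree_lt k G -> degree_lt k H -> degree_lt k (G + H).
Proof. by move=> dG dH m km; rewrite mcoeffD dG ?dH ?addr0. Qed.

Lemma degree_ltZ k c G : degree_lt k G -> degree_lt k (c *: G).
Proof. by move=> dG m km; rewrite mcoeffZ dG ?mulr0. Qed.

Lemma degree_ltN k G : degree_lt k G -> degree_lt k (- G).
Proof. by move=> dG m km; rewrite mcoeffN dG ?oppr0. Qed.

Lemma degree_ltM k l n G H :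
  (forall a b, (a < k -> b < l -> a + b < n)%N) ->
  degree_lt k G -> degree_lt l H -> degree_lt n (G * H).
Proof.
move=> kln dG dH m nm; rewrite mcoeffM big1 // => -[m1 m2] /= /eqP mE.
have [lek|ltk] := leqP k (mdeg m1); first by rewrite dG ?mul0r.
have [lel|ltl] := leqP l (mdeg m2); first by rewrite dH ?mulr0.
by have := kln _ _ ltk ltl; rewrite -mdegD -mE ltnNge nm.
Qed.

Lemma dhomog_degree_lt k G : G \is k.-homog -> degree_lt k.+1 G.
Proof.
by move=> hG m km; apply: (dhomog_nemf_coeff hG); rewrite neq_ltn [(k < _)%N]km orbT.
Qed.

Lemma dhomog_mmap1 (G : 'I_r -> {mpoly R[r]}) m :
  (forall i, G i \is 1.-homog) -> mmap1 G m \is (mdeg m).-homog.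
Proof.
move=> hG; rewrite mdegE /mmap1.
elim/big_rec2: _ => [|i x k _ IH]; first exact: dhomog1.
by apply: dhomogM => //; rewrite -[m i in X in X.-homog]mul1n; apply: dhomogMn.
Qed.

(** [L i] stands for [w] times the image of the variable [i]; the factor [w ^+ (D - mdeg a)] brings
    all monomials to the common denominator [w ^+ D]. *)
Definition subst (phi : R -> R) (w : R) (L : 'I_r -> {mpoly R[r]}) D G :=
  \sum_(a <- msupp G) (phi G@_a * w ^+ (D - mdeg a)) *: mmap1 L a.

Lemma mmap_subst (A : comNzRingType) (h : {rmorphism R -> A})
    (s : {rmorphism A -> A}) phi w L D G (y v : 'I_r -> A) :
  (forall p, h (phi p) = s (h p)) ->
  (forall i, mmap h y (L i) = h w * s (v i)) -> degree_lt D.+1 G ->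
  mmap h y (subst phi w L D G) = h w ^+ D * s (mmap h v G).
Proof.
move=> hphi yL dG; rewrite /subst (raddf_sum (mmap h y)).
have -> : mmap h v G = \sum_(a <- msupp G) h G@_a * mmap1 v a by [].
rewrite (raddf_sum s) mulr_sumr.
apply: eq_big_seq => a; rewrite mcoeff_msupp => Ga.
have aD : (mdeg a <= D)%N by rewrite leqNgt; apply: contraNN Ga => /dG->.
have -> : mmap1 L a = \prod_i L i ^+ a i by [].
rewrite /= mmapZ !rmorphM rmorphXn hphi rmorph_prod /=.
have -> : \prod_i mmap h y (L i ^+ a i) = h w ^+ mdeg a * s (mmap1 v a).
  rewrite mdegE -prodrXr rmorph_prod -big_split /=.
  by apply: eq_bigr => i _; rewrite !rmorphXn /= yL exprMn.
by rewrite -{2}(subnK aD) exprD; ring.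
Qed.

(* [tderiv G] generates the diagonal translations:
   G (Y - t) = G - t * tderiv G + O(t^2). *)
Definition tderiv G := \sum_i G^`M(i).

Lemma tderivM G H : tderiv (G * H) = tderiv G * H + G * tderiv H.
Proof.
rewrite /tderiv mulr_suml mulr_sumr -big_split /=.
by apply: eq_bigr => i _; rewrite mderivM.
Qed.

Lemma mcoeff_tderiv G m :
  (tderiv G)@_m = \sum_i G@_(m + U_(i)) *+ (m i).+1.
Proof. by rewrite /tderiv raddf_sum /=; apply: eq_bigr => i _; rewrite mcoeff_deriv. Qed.

Lemma degree_lt_tderiv k G : G \is k.-homog -> degree_lt k (tderiv G).
Proof.
move=> hG m km; rewrite mcoeff_tderiv big1 // => i _.
by rewrite (dhomog_degree_lt hG) ?mul0rn // mdegD mdeg1 addn1 ltnS.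
Qed.

Variable t : R.

(* [H] is the translate of the homogeneous form [G], up to terms of degree
   less than [k - 1]. *)
Definition translate k G H :=
  G \is k.-homog /\ degree_lt k.-1 (H - G + t *: tderiv G).

Lemma translate1 : translate 0 1 1.
Proof.
split; first exact: dhomog1.
by move=> m _; rewrite subrr add0r mcoeffZ mcoeff_tderiv big1 ?mulr0 // => i _;
  rewrite mcoeff1 mnmD_eq0 mnm1_eq0 andbF mul0rn.
Qed.

Lemma translateM k l G H G' H' :
  translate k G H -> translate l G' H' -> translate (k + l) (G * G') (H * H').
Proof.
move=> [hG dG] [hG' dG']; split; first exact: dhomogM.
set E := H - _ + _ in dG; set E' := H' - _ + _ in dG'.
have dtG := degree_lt_tderiv hG; have dtG' := degree_lt_tderiv hG'.
(* Substitute [H = G - t *: tderiv G + E], and likewise for [H']: each of the remaining products has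
   total degree less than [k + l - 1]. *)
have -> : H * H' - G * G' + t *: tderiv (G * G') =
    t *: (t *: (tderiv G * tderiv G')) - t *: (tderiv G * E')
    - t *: (E * tderiv G') + G * E' + E * G' + E * E'.
  rewrite tderivM /E /E' -!mul_mpolyC; ring.
have dlG := dhomog_degree_lt hG; have dlG' := dhomog_degree_lt hG'.
do !apply: degree_ltD; do ?apply: degree_ltN; do ?apply: degree_ltZ.
- by apply: degree_ltM dtG dtG'; lia.
- by apply: degree_ltM dtG dG'; lia.
- by apply: degree_ltM dG dtG'; lia.
- by apply: degree_ltM dlG dG'; lia.
- by apply: degree_ltM dG dlG'; lia.
- by apply: degree_ltM dG dG'; lia.
Qed.

Lemma translate_exp G H n : translate 1 G H -> translate n (G ^+ n) (H ^+ n).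
Proof.
move=> tG; elim: n => [|n IH]; first by rewrite !expr0; apply: translate1.
by rewrite !exprS -add1n; apply: translateM.
Qed.

Lemma translate_mmap1 (G H : 'I_r -> {mpoly R[r]}) m :
  (forall i, translate 1 (G i) (H i)) ->
  translate (mdeg m) (mmap1 G m) (mmap1 H m).
Proof.
move=> tGH; rewrite mdegE /mmap1.
elim/big_rec3: _ => [|i H' G' k _ IH]; first exact: translate1.
by apply: translateM; first exact: translate_exp.
Qed.

End DegreeBound.

(** Both right-hand sides equal [G + d * (e' - e)], while the left-hand sides are [G + (e' - e)] and
    [G + 1]; [d > 1] decides. *)
Lemma degree_gap d e e' E K k g G : (1 < d)%N -> (e < e')%N ->
  G = (E + (d * e + K * k.+1))%N -> (g + e)%N = G ->
  (g + e' < E + (K + (d * e' + K * k)))%N /\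
  (1 + G < E + (K + (d * e' + K * k)))%N.
Proof.
move=> d1 ee' -> gE; have de : (d * e + d <= d * e')%N.
  by rewrite -mulnSr leq_mul2l ee' orbT.
have [l eE] : exists l, e' = (e + l.+1)%N by exists (e' - e.+1)%N; lia.
have dl : (2 * l.+1 <= d * l.+1)%N by rewrite leq_mul2r d1 orbT.
by move: gE; rewrite eE !mulnDr mulnS; lia.
Qed.

(** * Exclusion of semi-invariant polynomials by comparing t-degrees *)

Section SemiInvariant.
Variables (F : fieldType) (charF : [pchar F] =i pred0).
Variables (d : nat) (P : {poly F}).
Hypotheses (d_gt1 : (1 < d)%N) (topP : top d P 1).
Variables (r K : nat) (mu : 'I_r -> 'I_r -> {poly F}) (b : 'I_r -> F).
Variables (beta : {poly F}) (bt : F).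
Hypotheses (top_mu : forall i j, top K (mu i j) (if i == j then b i else 0)).
Hypotheses (top_beta : top K beta bt) (bt_neq0 : bt != 0).
Hypotheses (b_neq0 : forall i, b i != 0) (b_inj : injective b).
Implicit Types (Q : {mpoly {poly F}[r]}) (m a : 'X_{1..r}).

Definition lin i : {mpoly {poly F}[r]} := \sum_j mu i j *: 'X_j.
Definition aff i := lin i - ('X * \sum_j mu i j)%:MP.

(* If beta * sigma(y_i) = sum_j mu_ij (y_j - t), where sigma is a ring
   morphism extending composition with P, then
   beta ^ D * sigma(Q(y)) = (tau D Q)(y) as soon as deg Q <= D. *)
Definition tau := subst (fun p => p \Po P) beta aff.

(** Up to a power of [beta], this is the image under [tau] of the degree [k] part of [Q], with the
    shift by t left out. *)
Definition level k Q : {mpoly {poly F}[r]} :=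
  \sum_(a <- msupp Q | mdeg a == k) (Q@_a \Po P) *: mmap1 lin a.

Lemma lin_homog i : lin i \is 1.-homog.
Proof.
by apply: rpred_sum => j _; apply: dhomogZ; rewrite dhomogX /= mdeg1.
Qed.

Lemma translate_aff i : translate 'X 1 (lin i) (aff i).
Proof.
split; first exact: lin_homog.
suff -> : aff i - lin i + 'X *: tderiv (lin i) = 0 by apply: degree_lt0.
have -> : tderiv (lin i) = (\sum_j mu i j)%:MP.
  rewrite /tderiv raddf_sum /=; apply: eq_bigr => j _.
  rewrite /lin raddf_sum /= (bigD1 j) //= mderivZ mderivX mnm1E eqxx scale1r.
  rewrite -[X in (X - _)%MM]add0m addmK mpolyX0 alg_mpolyC big1 ?addr0 // => k kj.
  by rewrite mderivZ mderivX mnm1E (negPf kj) scale0r scaler0.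
by rewrite /aff -mul_mpolyC mpolyCM; ring.
Qed.

(** The matrix [mu] is diagonal in t-degree [K], so to leading order each variable is an
    eigenvector. *)
Lemma topm_lin i : topm K (lin i) (b i *: 'X_i).
Proof.
move=> m; rewrite mcoeffZ mcoeffX /lin mcoeff_sum /=.
have -> : b i * (U_(i)%MM == m)%:R =
    \sum_j (if i == j then b i else 0) * (U_(j)%MM == m)%:R.
  rewrite (bigD1 i) //= eqxx big1 ?addr0 // => j.
  by rewrite eq_sym => /negPf->; rewrite mul0r.
apply: top_sum => j _; rewrite mcoeffZ mcoeffX -[K in top K _ _]addn0.
by apply: topM; rewrite // -polyC_natr; apply: topC.
Qed.

Lemma topm_mmap1_lin a : topm (K * mdeg a) (mmap1 lin a) (mmap1 b a *: 'X_[a]).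
Proof.
have -> : mmap1 b a *: 'X_[a] = mmap1 (fun i => b i *: 'X_i) a.
  rewrite mpolyXE_id /mmap1 -scaler_prod; apply: eq_bigr => i _.
  by rewrite exprZn.
by apply: topm_mmap1 => i; apply: topm_lin.
Qed.

Lemma mmap1_lin_homog a : mmap1 lin a \is (mdeg a).-homog.
Proof. by apply: dhomog_mmap1; apply: lin_homog. Qed.

Lemma mcoeff_mmap1_aff a m : ((mdeg a).-1 <= mdeg m)%N ->
  (mmap1 aff a)@_m = (mmap1 lin a)@_m - 'X * (tderiv (mmap1 lin a))@_m.
Proof.
move=> am; have [_ /(_ m am)] := translate_mmap1 a translate_aff.
by rewrite mcoeffD mcoeffB mcoeffZ => /eqP; rewrite addr_eq0 subr_eq => /eqP->; ring.
Qed.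

(** The shift by t affects only lower total degrees, and the exponent of [beta] is 0 on the
    monomials of top degree. *)
Lemma mcoeff_tau_top Q m : degree_lt (mdeg m).+1 Q ->
  (tau (mdeg m) Q)@_m = (level (mdeg m) Q)@_m.
Proof.
move=> dQ; rewrite /tau /subst /level [LHS]mcoeff_sum [RHS]mcoeff_sum [RHS]big_mkcond.
apply: eq_big_seq => a; rewrite mcoeff_msupp => Qa.
have am : (mdeg a <= mdeg m)%N.
  by rewrite leqNgt; apply: contraNN Qa => /dQ->.
have := degree_lt_tderiv (mmap1_lin_homog a).
have := dhomog_nemf_coeff (mmap1_lin_homog a) (m := m).
have := @mcoeff_mmap1_aff a m.
move: (mmap1 aff a) (mmap1 lin a) => A L AL hL dL.
rewrite [LHS]mcoeffZ AL ?(dL m am) ?(leq_trans (leq_pred _) am) // mulr0 subr0.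
case: eqP => [->|/eqP nam]; first by rewrite subnn mulr1 mcoeffZ.
by rewrite hL ?mulr0 // eq_sym.
Qed.

(** One degree below the top there are two sources: monomials of that degree, which carry one factor
    [beta], and the first-order effect of the shift on the top forms. *)
Lemma mcoeff_tau_next Q m : degree_lt (mdeg m).+2 Q ->
  (tau (mdeg m).+1 Q)@_m =
  beta * (level (mdeg m) Q)@_m - 'X * (tderiv (level (mdeg m).+1 Q))@_m.
Proof.
move=> dQ; rewrite /tau /subst /level.
have -> : tderiv (\sum_(a <- msupp Q | mdeg a == (mdeg m).+1)
      (Q@_a \Po P) *: mmap1 lin a) =
    \sum_(a <- msupp Q | mdeg a == (mdeg m).+1)
      (Q@_a \Po P) *: tderiv (mmap1 lin a).
  rewrite /tderiv.
  under eq_bigr do rewrite raddf_sum /=.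
  rewrite exchange_big /=; apply: eq_bigr => a _; rewrite scaler_sumr.
  by apply: eq_bigr => i _; rewrite mderivZ.
rewrite [LHS]mcoeff_sum [X in beta * X]mcoeff_sum [X in _ - 'X * X]mcoeff_sum.
rewrite [X in beta * X]big_mkcond [X in _ - 'X * X]big_mkcond.
rewrite !mulr_sumr -sumrB.
apply: eq_big_seq => a; rewrite mcoeff_msupp => Qa.
have am : (mdeg a <= (mdeg m).+1)%N.
  by rewrite leqNgt; apply: contraNN Qa => /dQ->.
have := degree_lt_tderiv (mmap1_lin_homog a).
have := dhomog_nemf_coeff (mmap1_lin_homog a) (m := m).
have := @mcoeff_mmap1_aff a m.
move: (mmap1 aff a) (mmap1 lin a) => A L AL hL dL.
rewrite [LHS]mcoeffZ AL; last by lia.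
have [aE|naE] := eqVneq (mdeg a) (mdeg m).+1.
  rewrite aE subnn expr0 mulr1 hL; last by rewrite aE neq_ltn ltnSn.
  by rewrite gtn_eqF // mcoeffZ mulr0; ring.
have am' : (mdeg a <= mdeg m)%N by lia.
rewrite (dL m am') mulr0 !subr0.
case: eqP => [->|/eqP nam]; first by rewrite subSnn expr1 mcoeffZ; ring.
by rewrite hL ?mulr0 ?subr0 // eq_sym.
Qed.

(** Composition with [P] multiplies t-degrees by [d] and each factor [lin] adds [K]; by diagonality
    only [a = m] contributes to the top coefficient. *)
Lemma top_level k e Q (qb : 'X_{1..r} -> F) m :
  (forall a, mdeg a = mdeg m -> top e Q@_a (qb a)) ->
  k = mdeg m -> top (d * e + K * k) (level k Q)@_m (qb m * mmap1 b m).
Proof.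
move=> tQ ->; rewrite /level mcoeff_sum /=.
have -> : qb m * mmap1 b m = \sum_(a <- msupp Q | mdeg a == mdeg m)
     qb a * (mmap1 b a *: 'X_[a])@_m.
  have [mQ|mQ] := boolP (m \in msupp Q).
    rewrite big_mkcond (bigD1_seq m) ?msupp_uniq //= eqxx big1 => [|a am].
      by rewrite mcoeffZ mcoeffX eqxx mulr1 addr0.
    by rewrite mcoeffZ mcoeffX (negPf am) !mulr0 if_same.
  have [_ <-] := tQ m erefl.
  rewrite (memN_msupp_eq0 mQ) coef0 mul0r big1_seq // => a /andP[_ aQ].
  rewrite mcoeffZ mcoeffX; case: eqP => [am|]; last by rewrite !mulr0.
  by rewrite -am aQ in mQ.
apply: top_sum => a /eqP am; rewrite mcoeffZ; apply: topM.
  by apply: top_comp topP _; [lia | exact: tQ].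
by rewrite -am; apply: topm_mmap1_lin.
Qed.

Lemma level_max_coef k Q : (exists2 a, mdeg a = k & Q@_a != 0) ->
  exists e a, [/\ mdeg a = k, (Q@_a)`_e != 0 &
    forall a', mdeg a' = k -> (size Q@_a' <= e.+1)%N].
Proof.
move=> [a0 a0k Qa0].
pose A e := has (fun a => (mdeg a == k) && (size Q@_a == e.+1)) (msupp Q).
have exA : exists e, A e.
  exists (size Q@_a0).-1; apply/hasP; exists a0; first by rewrite mcoeff_msupp.
  by rewrite a0k eqxx prednK ?size_poly_gt0 /=.
have bA e : A e -> (e <= \max_(a <- msupp Q) size Q@_a)%N.
  move=> /hasP[a aQ /andP[_ /eqP sa]]; apply: ltnW; rewrite -sa.
  by apply: leq_bigmax_seq.
case: (ex_maxnP exA bA) => e /hasP[a aQ /andP[/eqP ak /eqP sa]] maxe.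
exists e, a; split=> // [|a' a'k].
  by rewrite -[e]/(e.+1.-1) -sa -lead_coefE lead_coef_eq0 -mcoeff_msupp.
have [->|Qa'] := eqVneq Q@_a' 0; first by rewrite size_poly0.
have sa' : (0 < size Q@_a')%N by rewrite size_poly_gt0.
rewrite -(prednK sa') ltnS; apply: maxe; apply/hasP; exists a'.
  by rewrite mcoeff_msupp.
by rewrite a'k eqxx prednK /=.
Qed.

Lemma bmon_neq0 m : mmap1 b m != 0.
Proof. by apply/prodf_neq0 => i _; rewrite expf_neq0. Qed.

(* Let e be the maximal t-degree of the coefficients of Q of top degree D.
   Comparing the leading t-coefficients in degree D shows that the monomials
   of t-degree e all have the same eigenvalue. In degree D - 1 the term
   t * tderiv then exceeds the t-degree of the degree D part by
   exactly one; since composition with P multiplies t-degrees by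
   d > 1, nothing can cancel it. *)
Lemma semi_invariant_false D Q q c : (0 < D)%N -> degree_lt D.+1 Q ->
  (exists2 a, mdeg a = D & Q@_a != 0) -> q != 0 ->
  (forall m, q * (tau D Q)@_m = c * Q@_m) -> False.
Proof.
move=> D0 dQ exQ q0 qc.
have [e [a1 [a1D Qa1 maxe]]] := level_max_coef exQ.
pose qb a := (Q@_a)`_e.
have tQ a : mdeg a = D -> top e Q@_a (qb a) by move=> aD; split=> //; apply: maxe.
have tq := top_lead q0; set E := (size q).-1 in tq.
have ql0 : lead_coef q != 0 by rewrite lead_coef_eq0.
set ql := lead_coef q in tq ql0.
pose G := (E + (d * e + K * D))%N.
have tL m : mdeg m = D -> top G (q * (level D Q)@_m) (ql * (qb m * mmap1 b m)).
  move=> mD; apply: topM => //; apply: top_level; last by rewrite mD.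
  by move=> a aD; apply: tQ; rewrite aD.
have tcQ m : mdeg m = D -> top G (c * Q@_m) (ql * (qb m * mmap1 b m)).
  move=> mD; rewrite -qc -{1}mD mcoeff_tau_top ?mD //.
  exact: tL.
have v10 : ql * (qb a1 * mmap1 b a1) != 0 by rewrite !mulf_neq0 ?bmon_neq0.
have c0 : c != 0.
  by have := top_neq0 (tcQ _ a1D) v10; rewrite mulf_eq0 negb_or => /andP[].
have tc := top_lead c0; set g := (size c).-1 in tc.
have cl0 : lead_coef c != 0 by rewrite lead_coef_eq0.
set cl := lead_coef c in tc cl0.
have [gE _] := top_eq (topM tc (tQ _ a1D)) (tcQ _ a1D) (mulf_neq0 cl0 Qa1) v10.
(* Top t-coefficients in total degree [D]: all monomials of t-degree [e] share the eigenvalue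
   [cl / ql]. *)
have eig m : mdeg m = D -> qb m != 0 -> cl = ql * mmap1 b m.
  move=> mD qm; have := topM tc (tQ _ mD); rewrite gE => /top_inj/(_ (tcQ _ mD)).
  by rewrite mulrCA [LHS]mulrC => /(mulfI qm).
pose w m := \sum_i (ql * (qb (m + U_(i))%MM * mmap1 b (m + U_(i))%MM)) *+ (m i).+1.
have tE m : (mdeg m).+1 = D ->
    top (1 + G) (q * ('X * (tderiv (level D Q))@_m)) (w m).
  move=> mD; rewrite mulrCA -[w m]mul1r; apply: topM; first exact: topX.
  rewrite mcoeff_tderiv mulr_sumr; apply: top_sum => i _.
  by rewrite mulrnAr; apply: topMn; apply: tL; rewrite mdegD mdeg1 addn1.
(* Semi-invariance in total degree [D - 1], with the shift term moved to the right. *)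
have eqn m : (mdeg m).+1 = D -> q * (beta * (level (mdeg m) Q)@_m) =
    c * Q@_m + q * ('X * (tderiv (level D Q))@_m).
  move=> mD; have dQ' : degree_lt (mdeg m).+2 Q by rewrite mD.
  have := mcoeff_tau_next dQ'; rewrite mD => /esym/(congr1 ( *%R q)) e1.
  by move: (etrans e1 (qc m)); rewrite mulrBr => /eqP; rewrite subr_eq => /eqP.
have tB m e' (qb' : 'X_{1..r} -> F) : (mdeg m).+1 = D ->
    (forall a, mdeg a = mdeg m -> top e' Q@_a (qb' a)) ->
    top (E + (K + (d * e' + K * mdeg m))) (q * (beta * (level (mdeg m) Q)@_m))
      (ql * (bt * (qb' m * mmap1 b m))).
  by move=> mD tQ'; do 2!apply: topM => //; apply: top_level.
(* If some coefficient of total degree [D - 1] has t-degree above [e], the left side of [eqn]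
   dominates by [degree_gap]. Otherwise the shift term dominates. *)
have [[a2 [a2D sa2]]|small] := EM (exists a, (mdeg a).+1 = D /\ (e.+1 < size Q@_a)%N).
  have Qa2 : Q@_a2 != 0 by rewrite -size_poly_gt0; lia.
  have [e' [a3 [a3D Qa3 maxe']]] := level_max_coef (ex_intro2 _ _ a2 erefl Qa2).
  have ee' : (e < e')%N := leq_trans sa2 (maxe' a2 erefl).
  have a3D' : (mdeg a3).+1 = D by rewrite a3D.
  have tQ' a : mdeg a = mdeg a3 -> top e' Q@_a (Q@_a)`_e'.
    by move=> aD; split=> //; apply: maxe'; rewrite aD.
  have := tB a3 e' _ a3D' tQ'; rewrite eqn //.
  have t1 := topM tc (tQ' _ erefl); have t2 := tE _ a3D'.
  set N := (E + _)%N => t3.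
  have [N1 N2] : (g + e' < N)%N /\ (1 + G < N)%N.
    by apply: (degree_gap d_gt1 ee'); rewrite // a3D'.
  have /eqP := top_inj t3 (topD (top_widen N1 t1) (top_widen N2 t2)).
  by rewrite addr0 !mulf_eq0 (negPf ql0) (negPf bt_neq0) (negPf Qa3) (negPf (bmon_neq0 _)).
have [i a1i] : exists i, a1 i != 0%N.
  apply/existsP; apply: contraTT D0 => /existsPn a10; rewrite -a1D mdegE.
  by rewrite big1 // => i _; apply/eqP/negPn/a10.
(* At this monomial the shift term sees [a1]; the two other terms of [eqn] stay below t-degree
   [1 + G]. *)
pose m := (a1 - U_(i))%MM.
have mE : (m + U_(i))%MM = a1 by rewrite submK // lep1mP.
have mD : (mdeg m).+1 = D by rewrite -a1D -mE mdegD mdeg1 addn1.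
have tQ' a : mdeg a = mdeg m -> top e Q@_a (qb a).
  move=> am; split=> //; rewrite leqNgt; apply/negP => sa; apply: small.
  by exists a; rewrite am.
have t1 := topM tc (tQ' _ erefl); have t2 := tE _ mD; have t3 := tB m e qb mD tQ'.
have N1 : (g + e < 1 + G)%N by rewrite gE.
have N2 : (E + (K + (d * e + K * mdeg m)) < 1 + G)%N by rewrite /G -mD; nia.
move: t3; rewrite eqn // => t3.
have /eqP := top_inj (top_widen N2 t3) (topD (top_widen N1 t1) t2).
(* Only [j = i] survives in [w m]: for another [j], a nonzero coefficient would force [b i = b j] by
   [eig]. The factor [(m i).+1] is nonzero in characteristic zero. *)
rewrite add0r /w (bigD1 i) //= big1 ?addr0 => [|j ji].
  rewrite eq_sym mE -mulr_natr mulf_eq0 (negPf v10) /=.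
  by rewrite ((pcharf0P F).1 charF).
have mjD : mdeg (m + U_(j))%MM = D by rewrite mdegD mdeg1 addn1.
have [->|qj] := eqVneq (qb (m + U_(j))%MM) 0; first by rewrite mul0r mulr0 mul0rn.
have := eig _ mjD qj; rewrite (eig _ a1D Qa1) -mE => /(mulfI ql0).
rewrite !commr_mmap1_M; try by move=> *; apply: mulrC.
rewrite !mmap1U => /(mulfI (bmon_neq0 _)) /b_inj ij.
by rewrite ij eqxx in ji.
Qed.

End SemiInvariant.

(** * Minimal algebraic relations *)

Section Lead.
Variables (R : comNzRingType) (r : nat).
Implicit Types (p q : {mpoly R[r]}) (m a : 'X_{1..r}).

Lemma mlead_leP p m : (forall m', (m < m')%O -> p@_m' = 0) -> (mlead p <= m)%O.
Proof.
move=> pm; have [->|p0] := eqVneq p 0; first by rewrite mlead0 le0m.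
by rewrite leNgt; apply/negP => /pm /eqP; rewrite mleadc_eq0 (negPf p0).
Qed.

(** Only upper bounds for the leading monomials are multiplied, so the formula for the extreme
    coefficient holds even when that coefficient vanishes. *)
Lemma mlead_mmap1 (G : 'I_r -> {mpoly R[r]}) a :
  (forall i, (mlead (G i) <= U_(i)%MM)%O) ->
  (mlead (mmap1 G a) <= a)%O /\
  (mmap1 G a)@_a = \prod_i (G i)@_U_(i) ^+ a i.
Proof.
move=> lG; rewrite {2 3}[a]multinomUE_id /mmap1.
have lX i n : (mlead (G i ^+ n) <= (U_(i) *+ n)%MM)%O /\
    (G i ^+ n)@_(U_(i) *+ n)%MM = (G i)@_U_(i) ^+ n.
  elim: n => [|n [lGn cGn]].
    by rewrite mulm0n !expr0 mlead1 mcoeff1 eqxx lexx.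
  rewrite mulmS !exprS mleadcMW // cGn; split=> //.
  by apply: le_trans (mleadM_le _ _) _; apply: lem_add.
elim/big_rec3: _ => [|i c m p _ [lp pm]]; first by rewrite mlead1 mcoeff1 eqxx lexx.
have [lGi cGi] := lX i (a i).
rewrite mleadcMW // cGi pm; split=> //.
by apply: le_trans (mleadM_le _ _) _; apply: lem_add.
Qed.

Variables (phi : R -> R) (w : R) (L : 'I_r -> {mpoly R[r]}).
Hypothesis mlead_L : forall i, (mlead (L i) <= U_(i)%MM)%O.

Lemma mcoeff_subst_gt D p m : (mlead p < m)%O -> (subst phi w L D p)@_m = 0.
Proof.
move=> pm; rewrite /subst mcoeff_sum big1_seq // => a /andP[_ ap].
rewrite mcoeffZ [X in _ * X]mcoeff_gt_mlead ?mulr0 //.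
have [la _] := mlead_mmap1 a mlead_L.
by apply: le_lt_trans la _; apply: le_lt_trans pm; apply: msupp_le_mlead.
Qed.

(** Substitution does not raise leading monomials, so a monomial smaller than [mlead p] cannot reach
    it. *)
Lemma mcoeff_subst_mlead D p : p != 0 ->
  (subst phi w L D p)@_(mlead p) =
  phi p@_(mlead p) * w ^+ (D - mdeg (mlead p)) * \prod_i (L i)@_U_(i) ^+ mlead p i.
Proof.
move=> p0; rewrite /subst mcoeff_sum (bigD1_seq (mlead p)) ?msupp_uniq ?mlead_supp //=.
have [_ la] := mlead_mmap1 (mlead p) mlead_L.
rewrite mcoeffZ la [X in _ + X]big1_seq ?addr0 // => a /andP[am ap].
rewrite mcoeffZ [X in _ * X]mcoeff_gt_mlead ?mulr0 //.
have [lea _] := mlead_mmap1 a mlead_L; apply: le_lt_trans lea _.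
by rewrite lt_neqAle am msupp_le_mlead.
Qed.

End Lead.

Section Independence.
Variables (F : fieldType) (charF : [pchar F] =i pred0).
Variables (d : nat) (P : {poly F}).
Hypotheses (d_gt1 : (1 < d)%N) (topP : top d P 1).
Variables (r K : nat) (mu : 'I_r -> 'I_r -> {poly F}) (b : 'I_r -> F).
Variables (beta : {poly F}) (bt : F).
Hypotheses (top_mu : forall i j, top K (mu i j) (if i == j then b i else 0)).
Hypotheses (top_beta : top K beta bt) (bt_neq0 : bt != 0).
Hypotheses (b_neq0 : forall i, b i != 0) (b_inj : injective b).
Hypothesis mu_tri : forall i j, (U_(i)%MM < U_(j)%MM)%O -> mu i j = 0.
Variables (A : comNzRingType) (h : {rmorphism {poly F} -> A}) (y : 'I_r -> A).
Variable s : {rmorphism A -> A}.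
Hypothesis h_inj : injective h.
Hypothesis h_comp : forall p, h (p \Po P) = s (h p).
Hypothesis y_affine : forall i,
  h beta * s (y i) = \sum_j h (mu i j) * (y j - h 'X).

Lemma mmap_tau D Q : degree_lt D.+1 Q ->
  mmap h y Q = 0 -> mmap h y (tau P mu beta D Q) = 0.
Proof.
move=> dQ Q0; rewrite (mmap_subst (s := s) (v := y)) ?Q0 ?rmorph0 ?mulr0 // => i.
rewrite y_affine mmapB mmapC /= rmorphM (rmorph_sum h) mulr_sumr.
rewrite (raddf_sum (mmap h y)) -sumrB; apply: eq_bigr => j _.
by rewrite /= mmapZ mmapX mmap1U; ring.
Qed.

Lemma mlead_aff i : (mlead (aff mu i) <= U_(i)%MM)%O.
Proof.
apply: mlead_leP => m im; rewrite mcoeffB mcoeffC mcoeff_sum.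
have -> : (m == 0%MM) = false.
  by apply/eqP => m0; move: im; rewrite m0 ltNge le0m.
rewrite mulr0 subr0 big1 // => j _; rewrite mcoeffZ mcoeffX.
by case: eqP => [jm|_]; rewrite ?mulr0 // mu_tri ?mul0r // jm.
Qed.

(** Well-founded induction on the leading monomial of a supposed relation. *)
Lemma algebraically_independent Q : Q != 0 -> mmap h y Q != 0.
Proof.
have [m mE] : exists m, mlead Q = m by exists (mlead Q).
elim/(well_founded_ind (@ltom_wf r)): m Q mE => m IH Q mE Q0; apply/eqP => evQ.
pose D := mdeg m; pose q := Q@_m; have q0 : q != 0 by rewrite /q -mE mleadc_eq0.
have dQ : degree_lt D.+1 Q.
  by move=> m' Dm'; rewrite mcoeff_gt_mlead // mE; apply: lt_mdeg_ltmc.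
(* A relation of total degree 0 is a constant, excluded by injectivity of [h]. *)
have D0 : (0 < D)%N.
  rewrite lt0n; apply: contraNneq q0 => D0.
  have QE : Q = q%:MP.
    apply/mpolyP => m'; rewrite mcoeffC.
    have [->|m'0] := eqVneq m' 0%MM.
      by rewrite mulr1 /q; move/eqP: D0; rewrite mdeg_eq0 => /eqP->.
    by rewrite mulr0 dQ // D0 lt0n mdeg_eq0.
  by move: evQ; rewrite QE mmapC -(rmorph0 h) => /h_inj->.
pose c := (tau P mu beta D Q)@_m.
(* The coefficients of [m] cancel, so [Q'] is either a smaller relation or zero; in the latter case
   [Q] is semi-invariant. *)
pose Q' := q *: tau P mu beta D Q - c *: Q.
have [Q'0|Q'0] := eqVneq Q' 0.
  apply: (semi_invariant_false charF d_gt1 topP top_mu top_beta bt_neq0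
            b_neq0 b_inj (D := D) (Q := Q) (q := q) (c := c)) => //.
    by exists m.
  move=> m'; apply/eqP; rewrite -subr_eq0 -!mcoeffZ -mcoeffB.
  by rewrite -/Q' Q'0 mcoeff0.
have evQ' : mmap h y Q' = 0.
  by rewrite mmapB !mmapZ mmap_tau // evQ !mulr0 subr0.
suff lt : (mlead Q' < m)%O by move: (IH _ lt Q' erefl Q'0); rewrite evQ' eqxx.
have : (mlead Q' <= m)%O.
  apply: mlead_leP => m' mm'; rewrite mcoeffB !mcoeffZ.
  by rewrite (mcoeff_subst_gt _ _ mlead_aff) ?mE // [Q@__]mcoeff_gt_mlead ?mE // !mulr0 subr0.
rewrite le_eqVlt => /predU1P[Q'm|//]; case/eqP: Q'0.
apply/eqP; rewrite -mleadc_eq0 Q'm mcoeffB !mcoeffZ /c /q.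
by rewrite mulrC subrr.
Qed.

End Independence.

(** * Composition and derivation of power series *)

Section Composition.
Variable F : fieldType.
Implicit Types (f g : fps F) (p q P : {poly F}).

(** Congruence modulo t^N, used to transfer identities between polynomials to power series. *)
Definition agree N g p := forall i, (i < N)%N -> coefs g i = p`_i.

Definition truncation g N : {poly F} := \poly_(i < N) coefs g i.

Lemma agree_truncation N g : agree N g (truncation g N).
Proof. by move=> i iN; rewrite coef_poly iN. Qed.

Lemma agreeD N f g p q : agree N f p -> agree N g q -> agree N (f + g) (p + q).
Proof. by move=> fp gq i iN; rewrite coefsD coefD fp ?gq. Qed.

Lemma agreeM N f g p q : agree N f p -> agree N g q -> agree N (f * g) (p * q).
Proof.
move=> fp gq i iN; rewrite coefsM coefM; apply: eq_bigr => j _.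
by rewrite fp ?gq //; have := ltn_ord j; lia.
Qed.

Lemma agree_deriv N g p : agree N.+1 g p -> agree N (fps_deriv g) p^`().
Proof. by move=> gp i iN; rewrite coef_deriv /= gp. Qed.

Lemma agree_eq f g : (forall N, exists2 p, agree N f p & agree N g p) -> f = g.
Proof.
move=> fg; apply: fpsP => n; have [p fp gp] := fg n.+1.
by rewrite fp ?gp.
Qed.

(** This is composition when [P] has zero constant term: later coefficients of [g] then do not
    influence the coefficient of t^n. *)
Definition fps_comp P g : fps F :=
  FPS (fun n => (truncation g n.+1 \Po P)`_n).

Variable P : {poly F}.
Hypothesis P0 : P`_0 = 0.

Lemma coef_comp_small p N : (forall i, (i < N)%N -> p`_i = 0) ->
  forall i, (i < N)%N -> (p \Po P)`_i = 0.
Proof.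
(* t^N divides [p] and t divides [P], so t^N divides the composite. *)
move=> pN i iN; have -> : p = drop_poly N p * 'X^N.
  apply/polyP => j; rewrite coefMXn; case: ltnP => [/pN //|Nj].
  by rewrite coef_drop_poly subnK.
have -> : P = drop_poly 1 P * 'X.
  apply/polyP => -[|j]; first by rewrite coefMX.
  by rewrite coefMX coef_drop_poly addn1.
by rewrite comp_polyM comp_Xn_poly exprMn_comm ?mulrA ?coefMXn ?iN //; apply: mulrC.
Qed.

Lemma agree_comp N g p : agree N g p -> agree N (fps_comp P g) (p \Po P).
Proof.
move=> gp i iN; apply/eqP; rewrite -subr_eq0 -coefB -comp_polyB.
apply/eqP/(@coef_comp_small _ i.+1) => // j ji.
by rewrite coefB coef_poly ji gp ?subrr //; lia.
Qed.

Lemma fps_comp_poly p : fps_comp P (fps_of_poly p) = fps_of_poly (p \Po P).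
Proof. by apply: agree_eq => N; exists (p \Po P) => //; apply: agree_comp. Qed.

Fact fps_comp_is_zmod_morphism : zmod_morphism (fps_comp P).
Proof.
move=> f g; apply: agree_eq => N.
have aN h p : agree N h p -> agree N (- h) (- p).
  by move=> hp i iN; rewrite coefN -hp.
have af := @agree_truncation N f; have ag := @agree_truncation N g.
exists ((truncation f N - truncation g N) \Po P).
  by apply: agree_comp; apply: agreeD => //; apply: aN.
by rewrite comp_polyB; apply: agreeD; [|apply: aN]; apply: agree_comp.
Qed.

Fact fps_comp_is_monoid_morphism : monoid_morphism (fps_comp P).
Proof.
split; first by rewrite -(rmorph1 (@fps_of_poly F)) fps_comp_poly comp_polyC.
move=> f g; apply: agree_eq => N.
have af := @agree_truncation N f; have ag := @agree_truncation N g.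
exists ((truncation f N * truncation g N) \Po P).
  by apply: agree_comp; apply: agreeM.
by rewrite comp_polyM; apply: agreeM; apply: agree_comp.
Qed.

(** Packed explicitly, since the morphism property depends on the hypothesis [P0]. *)
Definition fps_comp_rmorphism : {rmorphism fps F -> fps F} :=
  HB.pack (fps_comp P)
    (GRing.isZmodMorphism.Build _ _ _ fps_comp_is_zmod_morphism)
    (GRing.isMonoidMorphism.Build _ _ _ fps_comp_is_monoid_morphism).

Lemma fps_deriv_comp g :
  fps_deriv (fps_comp P g) = fps_comp P (fps_deriv g) * fps_of_poly P^`().
Proof.
apply: agree_eq => N; have ag := @agree_truncation N.+1 g.
exists ((truncation g N.+1 \Po P)^`()); first exact/agree_deriv/agree_comp.
rewrite deriv_comp; apply: agreeM => //.
exact/agree_comp/agree_deriv.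
Qed.

End Composition.

Section EulerDerivation.
Variable F : fieldType.
Implicit Types (f g : fps F) (p P : {poly F}).
Local Notation ps := (@fps_of_poly F).

Lemma fps_derivD f g : fps_deriv (f + g) = fps_deriv f + fps_deriv g.
Proof. by apply: fpsP => n; rewrite /= mulrnDl. Qed.

Lemma fps_derivM f g :
  fps_deriv (f * g) = fps_deriv f * g + f * fps_deriv g.
Proof.
apply: agree_eq => N; have af := @agree_truncation F N.+1 f.
have ag := @agree_truncation F N.+1 g.
have agreeW h p : agree N.+1 h p -> agree N h p.
  by move=> hp i iN; apply: hp; apply: ltnW.
exists ((truncation f N.+1 * truncation g N.+1)^`()).
  exact/agree_deriv/agreeM.
rewrite derivM; apply: agreeD; apply: agreeM; by [apply: agree_deriv | apply: agreeW].
Qed.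

Lemma fps_deriv_poly p : fps_deriv (ps p) = ps p^`().
Proof. by apply: fpsP => n; rewrite /= coef_deriv. Qed.

Definition euler g := ps 'X * fps_deriv g.

Lemma eulerD f g : euler (f + g) = euler f + euler g.
Proof. by rewrite /euler fps_derivD mulrDr. Qed.

Fact euler_is_zmod_morphism : zmod_morphism euler.
Proof.
move=> f g; apply/(addIr (euler g)).
by rewrite -eulerD !subrK.
Qed.

HB.instance Definition _ := GRing.isZmodMorphism.Build _ _ euler
  euler_is_zmod_morphism.

Lemma eulerM f g : euler (f * g) = euler f * g + f * euler g.
Proof. by rewrite /euler fps_derivM; ring. Qed.

Lemma euler_poly p : euler (ps p) = ps ('X * p^`()).
Proof. by rewrite /euler fps_deriv_poly rmorphM. Qed.

(** The chain rule, multiplied by [P] so that no division occurs. *)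
Lemma euler_comp P g : P`_0 = 0 ->
  ps P * euler (fps_comp P g) = ps ('X * P^`()) * fps_comp P (euler g).
Proof.
move=> P0; rewrite /euler fps_deriv_comp //.
have -> : fps_comp P (ps 'X * fps_deriv g) = ps P * fps_comp P (fps_deriv g).
  have := rmorphM (fps_comp_rmorphism P0) (ps 'X) (fps_deriv g).
  by rewrite /= fps_comp_poly // comp_polyX.
have -> : ps ('X * P^`()) = ps 'X * ps P^`() by rewrite rmorphM.
by move: (fps_comp P _) (ps 'X) (ps P) (ps P^`()) => x y z t; ring.
Qed.

End EulerDerivation.

(** * The functional equation *)

Section FunctionalEquation.
Variables (F : fieldType) (d : nat) (P : {poly F}).
Hypotheses (topP : top d P 1).
Variables (A : comNzRingType) (h : {rmorphism {poly F} -> A}).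
Variables (D : {additive A -> A}) (s : {rmorphism A -> A}) (f : A).
Hypothesis DM : forall x y, D (x * y) = D x * y + x * D y.
Hypothesis Dh : forall p, D (h p) = h ('X * p^`()).
Hypothesis Ds : forall x, h P * D (s x) = h ('X * P^`()) * s (D x).
Hypothesis fE : f = h 'X + s f.
Local Notation B := ('X * P^`()).
Local Notation Df i := (iter i D f).

(** The extra factor [x] avoids the exponent [n - 1]. *)
Lemma derivation_exp x n : x * D (x ^+ n) = (x ^+ n * D x) *+ n.
Proof.
elim: n => [|n IH].
  by rewrite expr0 mulr0n -(rmorph1 h) Dh derivC mulr0 rmorph0 mulr0.
by rewrite exprS DM mulrDr IH mulrS; ring.
Qed.

Lemma derivation_X : D (h 'X) = h 'X.
Proof. by rewrite Dh derivX mulr1. Qed.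

(** Induction: apply [D] to the identity for [i], multiply by [P * B], and remove the derivative of
    [B ^+ (2 * i)]. Since [D] fixes t, it maps [Df j - t] to [Df j.+1 - t]. *)
Lemma derivation_iter_comp i : exists lam : nat -> {poly F},
  [/\ forall j, top (2 * i * d) (lam j) (if i == j then d%:R ^+ i else 0),
      forall j, (i < j)%N -> lam j = 0 &
      h B ^+ (2 * i) * s (Df i) = \sum_(j < i.+1) h (lam j) * (Df j - h 'X)].
Proof.
elim: i => [|i [lam [tlam lam0 lamE]]].
  exists (fun j => (j == 0)%:R); split=> [j|[|j]//|].
  - by rewrite muln0 mul0n expr0 eq_sym -polyC_natr; case: (0 == j)%N; apply: topC.
  - by rewrite muln0 expr0 mul1r big_ord1 /= rmorph1 mul1r {2}fE addrC addKr.
have tB : top d B d%:R by apply: top_Xderiv.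
have tDB : top d ('X * B^`()) (d%:R *+ d) by apply: top_Xderiv.
(* [u] collects the derivatives of [lam j] and of the power of [B]; [v] comes from differentiating
   [Df j - t]. *)
pose u j := P * B * ('X * (lam j)^`()) - P * ('X * B^`()) * lam j *+ (2 * i).
pose v j := if j is j'.+1 then P * B * lam j' else 0.
exists (fun j => u j + v j); split=> [j|j ij|].
- have -> : (2 * i.+1 * d = d + d + 2 * i * d)%N by rewrite mulnS mulnDl mul2n addnn.
  (* The two parts of [u] cancel in the top degree, as [d * (2 * i * d) = d * d * (2 * i)]; only the
     shifted term [v] remains, with one more factor [d]. *)
  have -> : (if i.+1 == j then d%:R ^+ i.+1 else 0 : F) =
     1 * d%:R * ((if i == j then d%:R ^+ i else 0) *+ (2 * i * d)) -
     1 * (d%:R *+ d) * (if i == j then d%:R ^+ i else 0) *+ (2 * i) +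
     (if j is j'.+1 then 1 * d%:R * (if i == j' then d%:R ^+ i else 0) else 0).
     case: j => [|j] /=; first by ring.
    by rewrite eqSS; case: (i == j); rewrite ?exprS; ring.
  apply: topD.
    apply: topB; first exact: topM (topM topP tB) (top_Xderiv (tlam j)).
    exact: topMn (topM (topM topP tDB) (tlam j)).
  case: j => [|j]; first exact: top0.
  exact: topM (topM topP tB) (tlam j).
- rewrite /u /v lam0 ?derivC ?mulr0 ?mul0rn ?subr0 ?add0r; last exact: ltnW.
  by case: j ij => // j ij; rewrite lam0 ?mulr0.
have DlamE := congr1 D lamE; rewrite DM in DlamE.
have expB := derivation_exp (h B) (2 * i).
have dB := Dh B.
have step : h B ^+ (2 * i.+1) * s (Df i.+1) =
    h P * h B * (\sum_(j < i.+1) D (h (lam j) * (Df j - h 'X))) -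
    (\sum_(j < i.+1) h (lam j) * (Df j - h 'X)) * (h P * h ('X * B^`())) *+ (2 * i).
  rewrite -raddf_sum -DlamE -lamE mulnS exprD expr2.
  have -> : h B * h B * h B ^+ (2 * i) * s (Df i.+1) =
    h B * h B ^+ (2 * i) * (h P * D (s (Df i))) by rewrite Ds /=; ring.
  rewrite -dB.
  have -> : h B ^+ (2 * i) * s (Df i) * (h P * D (h B)) *+ (2 * i) =
     s (Df i) * h P * (h B * D (h B ^+ (2 * i))).
    by rewrite expB; ring.
  by ring.
rewrite step mulr_sumr mulr_suml -sumrMnl -sumrB.
transitivity (\sum_(j < i.+1) (h (u j) * (Df j - h 'X) + h (v j.+1) * (Df j.+1 - h 'X))).
  apply: eq_bigr => j _; rewrite DM Dh raddfB derivation_X /u /v -iterS.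
  by rewrite rmorphB rmorphMn !rmorphM; ring.
rewrite big_split /=.
under [RHS]eq_bigr do rewrite rmorphD mulrDl.
rewrite [RHS]big_split /= [X in _ = X + _]big_ord_recr [X in _ = _ + X]big_ord_recl.
have -> : u i.+1 = 0.
  by rewrite /u lam0 // derivC !mulr0 mul0rn subrr.
by rewrite /= rmorph0 !mul0r add0r addr0.
Qed.

Variable delta : A -> A.
Hypothesis D_delta : forall x, D x = h 'X * delta x.

(** This is t^i delta^i = D (D - 1) ... (D - i + 1); the [c j] are signed Stirling numbers of the
    first kind. *)
Lemma falling_derivation i : exists c : nat -> F,
  [/\ c i = 1, forall j, (i < j)%N -> c j = 0 &
      h 'X ^+ i * iter i delta f = \sum_(j < i.+1) h (c j)%:P * Df j].
Proof.
elim: i => [|i [c [ci c0 cE]]].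
  exists (fun j => (j == 0)%:R); split=> // [[|]//|].
  by rewrite expr0 big_ord1 rmorph1.
pose v j := if j is j'.+1 then c j' else 0.
exists (fun j => v j - c j *+ i); split=> [|j ij|].
- by rewrite /v (c0 i.+1) // mul0rn subr0.
- rewrite (c0 j) ?mul0rn ?subr0; last exact: ltnW.
  by case: j ij => // j ij; rewrite /v c0.
have step : h 'X ^+ i.+1 * iter i.+1 delta f =
    D (h 'X ^+ i * iter i delta f) - h 'X ^+ i * iter i delta f *+ i.
  have expX : D (h 'X ^+ i) = h 'X ^+ i *+ i.
    case: i {ci c0 cE v} => [|i].
      by rewrite expr0 mulr0n -(rmorph1 h) Dh derivC mulr0 rmorph0.
    by rewrite -rmorphXn Dh derivXn mulrnAr /= -exprS rmorphMn.
  by rewrite DM expX D_delta iterS exprS; ring.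
rewrite step cE raddf_sum -sumrMnl -sumrB.
transitivity (\sum_(j < i.+1) (h (v j.+1)%:P * Df j.+1 - h (c j)%:P *+ i * Df j)).
  apply: eq_bigr => j _; rewrite DM Dh derivC mulr0 rmorph0 mul0r add0r -iterS.
  by rewrite mulrnAl.
rewrite sumrB.
under [RHS]eq_bigr do rewrite polyCB polyCMn rmorphB rmorphMn mulrBl.
rewrite [RHS]sumrB [X in X - _ = _]/= [in RHS]big_ord_recl /= [X in _ = _ - X]big_ord_recr /=.
by rewrite (c0 i.+1) // polyC0 rmorph0 mul0rn !mul0r add0r addr0.
Qed.

End FunctionalEquation.

Section DifferentialTranscendence.
Variables (F : fieldType) (charF : [pchar F] =i pred0).
Variables (d : nat) (P : {poly F}) (f : fps F).
Hypotheses (d_gt1 : (1 < d)%N) (topP : top d P 1) (P0 : P`_0 = 0).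
Hypothesis fE : f = fps_of_poly 'X + fps_comp P f.
Local Notation ps := (@fps_of_poly F).
Local Notation B := ('X * P^`()).

Lemma natrF_eq0 k : (k%:R == 0 :> F) = (k == 0)%N.
Proof. by move/pcharf0P: charF => ->. Qed.

(** Makes the eigenvalues distinct. *)
Lemma natrF_exp_inj : injective (fun k => (d%:R : F) ^+ k).
Proof.
move=> k l /eqP; rewrite -!natrX.
wlog kl : k l / (k <= l)%N.
  by move=> wl; case: (leqP k l) => [|/ltnW] /wl // h; rewrite eq_sym => /h.
have dkl : (d ^ k <= d ^ l)%N by rewrite leq_exp2l.
rewrite eq_sym -subr_eq0 -natrB // natrF_eq0 subn_eq0 leq_exp2l // => lk.
by apply/eqP; rewrite eqn_leq kl.
Qed.

Lemma ltm_mnm1 n (i j : 'I_n) : (U_(i)%MM < U_(j)%MM)%O = (j < i)%N.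
Proof.
have eij : mdeg U_(i)%MM = mdeg U_(j)%MM by rewrite !mdeg1.
apply/idP/idP => [/(ltmcP eij)[k eqk]|ji].
  rewrite !mnm1E; case: (eqVneq j k) => [jk|_]; last by case: (i == k).
  move=> ik; rewrite ltnNge leq_eqVlt; apply/norP; split.
    by apply: contraTN ik => /eqP/val_inj->; rewrite jk eqxx.
  apply/negP => ij; have := eqk i; rewrite -jk ij => /(_ isT).
  by rewrite !mnm1E eqxx -val_eqE /= gtn_eqF.
apply/(ltmcP eij); exists j => [k kj|]; rewrite !mnm1E.
  by rewrite -!val_eqE /= !gtn_eqF //; apply: ltn_trans ji.
by rewrite eqxx -val_eqE /= gtn_eqF.
Qed.

Lemma sum_ord_sub (V : nmodType) n (i : 'I_n.+1) (a : nat -> V) :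
  (forall j, (n - i < j)%N -> a j = 0) ->
  \sum_(j < (n - i).+1) a j = \sum_(j < n.+1) a (n - j)%N.
Proof.
move=> a0; have ni : (n - i < n.+1)%N by lia.
rewrite (big_ord_widen _ a ni) big_mkcond /= (reindex_inj rev_ord_inj).
apply: eq_bigr => j _ /=; rewrite subSS; case: ifP => // /negbT.
by rewrite -ltnNge ltnS => /a0.
Qed.

(* Indices are reversed because the monomial order of multinomials makes
   the variable of index 0 the largest one. *)
Lemma euler_independent n (Q : {mpoly {poly F}[n.+1]}) : Q != 0 ->
  mmap ps (fun i => iter (n - i) (@euler F) f) Q != 0.
Proof.
have [lam lamP] := choice (derivation_iter_comp topP (@eulerM F) (@euler_poly F)
  (fun g => euler_comp g P0) (s := fps_comp_rmorphism P0) fE).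
(* The row of [D^(n - i) f] comes with [B ^+ (2 * (n - i))]; the factor [B ^+ (2 * i)] gives all
   rows the common multiplier [B ^+ (2 * n)], and turns the eigenvalue [d ^ (n - i)] into
   [d ^ (n + i)]. *)
pose mu (i j : 'I_n.+1) := B ^+ (2 * i) * lam (n - i)%N (n - j)%N.
have tB : top d B d%:R by apply: top_Xderiv.
have d0 : (d%:R : F) != 0 by rewrite natrF_eq0 -lt0n ltnW.
apply: (@algebraically_independent F charF d P d_gt1 topP n.+1 (2 * n * d) mu
  (fun i => d%:R ^+ (n + i)) (B ^+ (2 * n)) (d%:R ^+ (2 * n)) _ _ _ _ _ _ _ _ _
  (fps_comp_rmorphism P0)).
- move=> i j; have [tl _ _] := lamP (n - i)%N.
  have -> : (2 * n * d = d * (2 * i) + 2 * (n - i) * d)%N.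
    by have := ltn_ord i; rewrite ltnS => /subnKC {1}<-; lia.
  have -> : (if i == j then (d%:R : F) ^+ (n + i) else 0) = d%:R ^+ (2 * i) *
     (if (n - i == n - j)%N then d%:R ^+ (n - i) else 0).
    have -> : (n - i == n - j)%N = (i == j).
      rewrite -val_eqE /=; have := ltn_ord i; have := ltn_ord j.
      by move=> jn im; apply/eqP/eqP; lia.
    case: ifP => _; last by rewrite mulr0.
    by rewrite -exprD; congr (_ ^+ _); have := ltn_ord i; lia.
  by apply: topM; [apply: top_exp | apply: tl].
- by rewrite [(2 * n * d)%N]mulnC; apply: top_exp.
- by rewrite expf_neq0.
- by move=> i; rewrite expf_neq0.
- by move=> i j /natrF_exp_inj/addnI/val_inj.
- move=> i j; rewrite ltm_mnm1 => ji; have [_ l0 _] := lamP (n - i)%N.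
  by rewrite /mu l0 ?mulr0 //; have := ltn_ord i; lia.
- exact: fps_of_poly_inj.
- by move=> p; rewrite /= fps_comp_poly.
- move=> i; have [_ l0 lE] := lamP (n - i)%N.
  have -> : (2 * n = 2 * i + 2 * (n - i))%N by have := ltn_ord i; lia.
  rewrite exprD rmorphM -mulrA !rmorphXn lE.
  rewrite (sum_ord_sub (n := n) (a := fun j => ps (lam (n - i)%N j) *
      (iter j (@euler F) f - ps 'X))) => [|j ij]; last by rewrite l0 // rmorph0 mul0r.
  rewrite mulr_sumr; apply: eq_bigr => j _; rewrite mulrA -rmorphXn -rmorphM.
  by [].
Qed.

Lemma clear_denominators n (Q : {mpoly (ratfun F)[n]}) :
  exists c (Q' : {mpoly {poly F}[n]}), c != 0 /\
    FracField.tofrac c *: Q = map_mpoly (@FracField.tofrac _) Q'.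
Proof.
elim/mpolyind: Q => [|x m Q _ _ [c [Q' [c0 cQ]]]].
  by exists 1, 0; rewrite oner_eq0 scaler0 raddf0.
have v0 : \d_(repr x) != 0 by rewrite denom_ratioP.
exists (\d_(repr x) * c), ((\n_(repr x) * c) *: 'X_[m] + \d_(repr x) *: Q').
split; first by rewrite mulf_neq0.
rewrite (raddfD (map_mpoly _)) /= 2!map_mpolyZ map_mpolyX -cQ scalerDr !scalerA -!rmorphM.
suff -> : FracField.tofrac (\d_(repr x) * c) * x = FracField.tofrac (\n_(repr x) * c).
  by [].
rewrite {2}[x]ratfun_repr !rmorphM /= mulrAC; congr (_ * _).
by rewrite mulrC divfK // tofrac_eq0.
Qed.

Lemma laurent_of_ratfun_poly (p : {poly F}) :
  laurent_of_ratfun (FracField.tofrac p) = laurent_of_fps (ps p).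
Proof.
rewrite -[FracField.tofrac p]divr1 -(rmorph1 (@FracField.tofrac _)).
by rewrite laurent_of_ratfunE ?oner_eq0 // /laurent_of_fps !rmorph1 divr1.
Qed.

Lemma mmap_map_mpoly n (Q : {mpoly {poly F}[n]}) (v : 'I_n -> fps F) :
  mmap (@laurent_of_ratfun F) (fun i => laurent_of_fps (v i))
    (map_mpoly (@FracField.tofrac _) Q) = laurent_of_fps (mmap ps v Q).
Proof.
pose k := maxn (msize Q) (msize (map_mpoly (@FracField.tofrac _) Q)).
rewrite (mmapE k) ?leq_maxr // [X in laurent_of_fps X](mmapE k) ?leq_maxl //.
rewrite /laurent_of_fps (rmorph_sum (@FracField.tofrac (fps F))).
apply: eq_bigr => m _; rewrite mcoeff_map_mpoly [RHS]rmorphM; congr (_ * _).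
  exact: laurent_of_ratfun_poly.
by rewrite /mmap1 rmorph_prod; apply: eq_bigr => i _; rewrite rmorphXn.
Qed.

Lemma mmap_msym n (s : 'S_n) (v : 'I_n -> fps F) (Q : {mpoly {poly F}[n]}) :
  mmap ps v (msym s Q) = mmap ps (v \o s) Q.
Proof.
elim/mpolyind: Q => [|c m Q _ _ IH]; first by rewrite !raddf0.
rewrite msymD msymZ msymX !mmapD IH !mmapZ !mmapX; congr (_ * _ + _).
rewrite /mmap1 (reindex_inj (@perm_inj _ s)); apply: eq_bigr => i _.
by rewrite mnmE permK.
Qed.

(** A relation between the derivatives becomes, after clearing denominators, one between the Euler
    derivatives, by a triangular substitution which preserves nonvanishing. *)
Lemma diff_transcendental_functional_eq : diff_transcendental f.
Proof.
move=> n Q Q0; apply/eqP => evQ.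
have [c [Q1 [c0 cQ]]] := clear_denominators Q.
have Q10 : Q1 != 0.
  apply: contraNneq Q0 => Q10; move: cQ; rewrite Q10 raddf0 => /eqP.
  by rewrite mscalerI tofrac_eq0 (negPf c0).
pose s := perm (@rev_ord_inj n.+1); pose Q2 := msym s Q1.
have Q20 : Q2 != 0 by rewrite -(inj_eq (@inj_msym _ _ s)) raddf0 in Q10.
pose v (i : 'I_n.+1) := iter (n - i) (@fps_deriv F) f.
have evQ2 : mmap ps v Q2 = 0.
  have -> : mmap ps v Q2 = mmap ps (fun i : 'I_n.+1 => iter i (@fps_deriv F) f) Q1.
    rewrite mmap_msym; congr (mmap _ _ _); apply/funext => i /=.
    by rewrite /v permE /= subSS subKn // -ltnS.
  apply/eqP; rewrite -tofrac_eq0 -/(laurent_of_fps _) -mmap_map_mpoly -cQ mmapZ.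
  by rewrite -/(diff_eval Q f) evQ mulr0.
have [a aP] := choice (falling_derivation f (@eulerM F) (@euler_poly F)
  (fun g => erefl (euler g))).
(* [L i] expresses t^n times the derivative of order [n - i] through Euler derivatives; ['X^i]
   completes t^(n - i) to t^n. *)
pose L (i : 'I_n.+1) : {mpoly {poly F}[n.+1]} :=
  \sum_(j < n.+1) ('X^i * (a (n - i)%N (n - j)%N)%:P) *: 'X_j.
have mL i : (mlead (L i) <= U_(i)%MM)%O.
  apply: mlead_leP => m im; rewrite mcoeff_sum big1 // => j _.
  rewrite mcoeffZ mcoeffX; case: eqP => [jm|_]; last by rewrite mulr0.
  have [_ a0 _] := aP (n - i)%N; rewrite a0 ?mulr0 ?mul0r //.
  by move: im; rewrite -jm ltm_mnm1; have := ltn_ord i; lia.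
have cL i : (L i)@_U_(i) = 'X^i.
  have [a1 _ _] := aP (n - i)%N.
  rewrite mcoeff_sum (bigD1 i) //= mcoeffZ mcoeffX eqxx a1 !mulr1 big1 ?addr0 // => j ji.
  by rewrite mcoeffZ mcoeffX eq_mnm1 (negPf ji) mulr0.
pose Q3 := subst idfun 'X^n L (msize Q2) Q2.
have Q30 : Q3 != 0.
  have : Q3@_(mlead Q2) != 0.
    rewrite mcoeff_subst_mlead //= !mulf_neq0 ?mleadc_eq0 ?expf_neq0 ?polyX_eq0 //.
    by apply/prodf_neq0 => i _; rewrite cL !expf_neq0 ?polyX_eq0.
  by apply: contraNneq => ->; rewrite mcoeff0.
have := euler_independent Q30.
rewrite (mmap_subst (s := idfun) (v := v)) ?evQ2 ?mulr0 ?eqxx //.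
  move=> i; have [_ a0 aE] := aP (n - i)%N.
  rewrite (raddf_sum (mmap ps _)) /=.
  have -> : ps 'X^n = ps 'X ^+ i * ps 'X ^+ (n - i).
    by rewrite rmorphXn -exprD subnKC // -ltnS.
  rewrite -mulrA /v aE (sum_ord_sub (n := n)
     (a := fun j => ps (a (n - i)%N j)%:P * iter j (@euler F) f)) => [|j ij].
    rewrite mulr_sumr; apply: eq_bigr => j _.
    by rewrite mmapZ mmapX mmap1U rmorphM rmorphXn mulrA.
  by rewrite a0 // rmorph0 mul0r.
by move=> m Qm; apply/memN_msupp_eq0/msize_mdeg_ge/ltnW.
Qed.

End DifferentialTranscendence.

(** * Complete trees *)

Section CompleteTrees.
Variable S : {fset nat}.
Hypothesis S_gt1 : forall k, k \in S -> (1 < k)%N.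

Fixpoint seqs_of (A : Type) (k : nat) (s : seq A) : seq (seq A) :=
  if k is k'.+1 then [seq x :: l | x <- s, l <- seqs_of k' s] else [:: [::]].

Fixpoint trees_of_height (h : nat) : seq ptree :=
  if h is h'.+1 then
    map Node (flatten [seq seqs_of k (trees_of_height h') | k <- enum_fset S])
  else [:: Node [::]].

Lemma all_flatten (A : Type) (p : pred A) (ss : seq (seq A)) :
  all p (flatten ss) = all (all p) ss.
Proof. by elim: ss => //= s ss IH; rewrite all_cat IH. Qed.

Lemma mem_seqs_of (A : eqType) k (s l : seq A) :
  (l \in seqs_of k s) = (size l == k) && all (mem s) l.
Proof.
elim: k l => [|k IH] [|x l]; rewrite ?inE //=.
  by apply/negP => /allpairsP[[y m] [_ _]].
apply/allpairsP/idP => [[[y m] /= [ys ms [-> ->]]]|/and3P[lk xs ls]].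
  by move: ms; rewrite IH eqSS ys.
by exists (x, l); split=> //=; rewrite IH ls andbT.
Qed.

(** The lists are pairwise disjoint because [key] recovers the index from any member. *)
Lemma uniq_flatten_key (A : eqType) (I : eqType) (key : A -> I) (r : seq I)
    (G : I -> seq A) :
  uniq r -> (forall i, i \in r -> uniq (G i)) ->
  (forall i x, x \in G i -> key x = i) -> uniq (flatten [seq G i | i <- r]).
Proof.
move=> + + keyG; elim: r => //= i r IH /andP[ir ur] uG.
rewrite cat_uniq uG ?mem_head //= IH // => [|j jr]; last first.
  by apply: uG; rewrite inE jr orbT.
rewrite andbT; apply/hasPn => x /flatten_mapP[j jr xj]; apply/negP => xi.
by rewrite -(keyG _ _ xi) (keyG _ _ xj) jr in ir.
Qed.

Lemma seqs_of_uniq (A : eqType) k (s : seq A) : uniq s -> uniq (seqs_of k s).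
Proof.
move=> us; elim: k => //= k IH; apply: allpairs_uniq => //.
by move=> [x l] [y m] _ _ /= [-> ->].
Qed.

Lemma trees_of_height_uniq h : uniq (trees_of_height h).
Proof.
elim: h => //= h IH; rewrite map_inj_uniq; last by move=> ? ? [].
apply: (@uniq_flatten_key _ _ size).
- exact: fset_uniq.
- by move=> k _; apply: seqs_of_uniq.
- by move=> k l; rewrite mem_seqs_of => /andP[/eqP].
Qed.

(** The enumeration is exact: a complete tree of height [h] is one whose leaf depths all equal
    [h]. *)
Lemma mem_trees_of_height h T :
  (T \in trees_of_height h) = is_Stree S T && all (pred1 h) (leaf_depths T).
Proof.
elim: h T => [|h IH] [cs] /=.
  rewrite inE; apply/eqP/idP => [[->]//|/andP[_]].
  case: cs => //= c cs; rewrite map_cat all_cat all_map.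
  have := nleaves_gt0 c; rewrite /nleaves.
  by case: (leaf_depths c).
rewrite (mem_map (fun x y => _)); last by move=> x y [].
apply/flatten_mapP/idP => [[k kS]|].
  rewrite mem_seqs_of => /andP[/eqP sk /allP cT].
  have cs0 : nilp cs = false by rewrite /nilp sk; have := S_gt1 kS; case: k {kS sk}.
  rewrite cs0 sk kS /= all_map all_flatten all_map.
  apply/andP; split; apply/allP => c /cT; rewrite /= IH => /andP[//].
case/andP=> /andP[]; have [//|_ /= kS aS] := boolP (nilp cs).
rewrite all_map all_flatten all_map => /allP ah.
exists (size cs) => //; rewrite mem_seqs_of eqxx /=; apply/allP => c cc /=.
rewrite IH (allP aS _ cc) /=; apply/allP => x xc.
by have /allP/(_ x xc) := ah c cc.
Qed.

(** Inner vertices have at least two children: one child has more than [h] leaves by induction,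
    another adds at least one. *)
Lemma height_lt_nleaves h T : T \in trees_of_height h -> (h < nleaves T)%N.
Proof.
elim: h T => [|h IH] T; first by rewrite nleaves_gt0.
move=> /mapP[cs /flatten_mapP[k kS]]; rewrite mem_seqs_of => /andP[/eqP sk /allP cT] ->.
rewrite nleaves_Node; move: (S_gt1 kS); rewrite -sk.
case: cs cT {sk} => [|c [|c' cs]] //= cT _.
have := IH c (cT c (mem_head _ _)); have := nleaves_gt0 c'; lia.
Qed.

(** Trees with [n] leaves have height below [n], so heights below [N] suffice; the first leaf depth
    recovers the height and separates the lists. *)
Lemma ncompleteE N n : (n <= N)%N ->
  ncomplete S n =
  (\sum_(h < N) count (fun T => nleaves T == n) (trees_of_height h))%N.
Proof.
move=> nN; pose ts := flatten [seq trees_of_height h | h <- iota 0 N].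
have tsu : uniq ts.
  apply: (@uniq_flatten_key _ _ (fun T => head 0%N (leaf_depths T))).
  - exact: iota_uniq.
  - by move=> h _; apply: trees_of_height_uniq.
  - move=> h T; rewrite mem_trees_of_height => /andP[_].
    have := nleaves_gt0 T; rewrite /nleaves.
    by case: (leaf_depths T) => //= x l _ /andP[/eqP].
rewrite /ncomplete.
have -> : fset_set (complete_Strees S n) =
    [fset T in [seq T <- ts | nleaves T == n]]%fset.
  apply/fsetP => T; rewrite in_fset_set; last exact: finite_complete_Strees.
  rewrite !inE mem_filter; apply/idP/idP.
    rewrite inE => -[ST cT nT]; rewrite nT eqxx /=.
    pose h := head 0%N (leaf_depths T).
    have Th : T \in trees_of_height h.
      rewrite mem_trees_of_height ST /= /h; move: cT; rewrite /complete_tree.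
      by case: (leaf_depths T) => //= x l; rewrite eqxx.
    apply/flatten_mapP; exists h => //; rewrite mem_iota /= add0n.
    by apply: leq_trans nN; rewrite -nT; apply: height_lt_nleaves.
  move=> /andP[/eqP nT /flatten_mapP[h _]]; rewrite mem_trees_of_height.
  move=> /andP[ST aT]; rewrite inE; split=> //.
  rewrite /complete_tree; case: (leaf_depths T) aT => //= x l /andP[/eqP-> al].
  exact: al.
rewrite card_fseq undup_id ?filter_uniq // size_filter /ts.
rewrite count_flatten -map_comp sumnE big_map -{1}[N]subn0 big_mkord.
by apply: eq_bigr.
Qed.

Variable F : fieldType.

Definition node_poly : {poly F} := \sum_(k <- enum_fset S) 'X^k.

Definition height_poly h : {poly F} :=
  \sum_(T <- trees_of_height h) 'X^(nleaves T).

Lemma comp_node_poly q : node_poly \Po q = \sum_(k <- enum_fset S) q ^+ k.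
Proof.
rewrite /node_poly (raddf_sum (comp_poly q)); apply: eq_bigr => k _.
exact: comp_Xn_poly.
Qed.

Lemma sum_seqs_of k (s : seq ptree) :
  \sum_(l <- seqs_of k s) 'X^(sumn (map nleaves l)) =
  (\sum_(T <- s) 'X^(nleaves T)) ^+ k :> {poly F}.
Proof.
elim: k => [|k IH]; first by rewrite big_seq1 !expr0.
rewrite exprS -IH big_allpairs_dep mulr_suml; apply: eq_bigr => T _.
by rewrite mulr_sumr; apply: eq_bigr => l _; rewrite /= exprD.
Qed.

Lemma height_polyS h : height_poly h.+1 = node_poly \Po height_poly h.
Proof.
rewrite comp_node_poly /height_poly /= big_map big_flatten big_map.
apply: eq_big_seq => k kS; rewrite -sum_seqs_of; apply: eq_big_seq => l.
rewrite mem_seqs_of => /andP[/eqP lk _]; rewrite nleaves_Node /nilp lk.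
by have := S_gt1 kS; case: (k) => //.
Qed.

(** Splitting at the root puts [node_poly] outside, whereas the functional equation needs it inside;
    both describe the same iterate. *)
Lemma height_polySr h : height_poly h.+1 = height_poly h \Po node_poly.
Proof.
elim: h => [|h IH]; last by rewrite height_polyS {1}IH comp_polyA -height_polyS.
rewrite height_polyS /height_poly !big_seq1 nleaves_Node /= expr1.
by rewrite comp_polyXr comp_polyX.
Qed.

(** Trees of height at least [M] have more than [M] leaves, so the coefficients up to t^M are
    already final. *)
Lemma agree_complete_gf N M : (N <= M.+1)%N ->
  agree N (complete_gf F S) (\sum_(h < M) height_poly h).
Proof.
move=> NM n nN; have nM : (n <= M)%N by rewrite -ltnS; apply: leq_trans NM.
rewrite coef_sum /= (ncompleteE nM) natr_sum; apply: eq_bigr => h _.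
rewrite /height_poly coef_sum -sum1_count natr_sum [LHS]big_mkcond.
by apply: eq_bigr => T _; rewrite coefXn eq_sym; case: eqP.
Qed.

Lemma node_poly0 : node_poly`_0 = 0.
Proof.
rewrite /node_poly coef_sum big1_seq // => k /andP[_ kS].
by rewrite coefXn; have := S_gt1 kS; case: k {kS}.
Qed.

Lemma complete_gf_eq :
  complete_gf F S = fps_of_poly 'X + fps_comp node_poly (complete_gf F S).
Proof.
apply: agree_eq => N; exists (\sum_(h < N.+1) height_poly h).
  by apply: agree_complete_gf; lia.
(* Height 0 contributes t; every other height is the previous one composed with [node_poly]. *)
have -> : \sum_(h < N.+1) height_poly h =
    'X + ((\sum_(h < N) height_poly h) \Po node_poly).
  rewrite [LHS]big_ord_recl (raddf_sum (comp_poly node_poly)); congr (_ + _).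
    by rewrite /height_poly big_seq1 expr1.
  by apply: eq_bigr => h _; apply: height_polySr.
apply: agreeD => //; apply: agree_comp; first exact: node_poly0.
exact: agree_complete_gf.
Qed.

(** Take [d] to be the maximum of [S]; it occurs once among the exponents, so the leading
    coefficient is 1. *)
Lemma top_node_poly : S != fset0 -> exists2 d, (1 < d)%N & top d node_poly 1.
Proof.
case/fset0Pn => k0 k0S.
have [d dS dmax] : exists2 d, d \in S & forall k, k \in S -> (k <= d)%N.
  pose A k := k \in S.
  have bA k : A k -> (k <= \max_(j <- enum_fset S) j)%N.
    by move=> kS; apply: leq_bigmax_seq.
  by have [d dS dmax] := ex_maxnP (ex_intro A k0 k0S) bA; exists d.
exists d; first exact: S_gt1.
have -> : 1 = \sum_(k <- enum_fset S) (d == k)%:R :> F.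
  rewrite (bigD1_seq d) ?fset_uniq //= eqxx big1 ?addr0 // => k kd.
  by rewrite eq_sym (negPf kd).
rewrite /node_poly big_seq [X in top _ _ X]big_seq.
apply: top_sum => k kS; split; last by rewrite coefXn.
by rewrite size_polyXn ltnS dmax.
Qed.

End CompleteTrees.

Theorem theorem1p2 (R : realType) (S : {fset nat})
  (S_neq0 : S != fset0%fset)
  (S_gt1 : forall k : nat, k \in S -> (1 < k)%N) :
  diff_transcendental (complete_gf R[i]%C S).
Proof.
have [d d_gt1 topP] := top_node_poly S_gt1 (R[i]%C : fieldType) S_neq0.
exact: (diff_transcendental_functional_eq (@pchar_num _) d_gt1 topP
  (node_poly0 S_gt1 _) (complete_gf_eq S_gt1 _)).
Qed.
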